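(* For $n\in\mathbb N$, consider the sub-Riemannian manifold $(\mathbb R^3,\Delta^n,g)$, where $\mathbb R^3$ has coordinates $(x_1,x_2,x_3)$, $\Delta^n=\mathrm{span}\{f_1,f_2\}$ with $$f_1=\frac{\partial}{\partial x_1},\qquad f_2=(1-x_1)\frac{\partial}{\partial x_2}+x_1^n\frac{\partial}{\partial x_3},$$ and $g$ is the metric on $\Delta^n$ making $f_1,f_2$ orthonormal. Let $\gamma(t)=(0,t,0)$, $t\in[0,1]$. (i) For any $n\ge2$, $\gamma$ is the unique strictly singular extremal in $(\mathbb R^3,\Delta^n)$ passing through the origin, up to reparameterization. (ii) If $n\ge2$ is even, $\gamma$ is locally length-minimizing in $(\mathbb R^3,\Delta^n,g)$. (iii) If $n\ge3$ is odd, $\gamma$ is not length-minimizing in $(\mathbb R^3,\Delta^n,g)$, not even locally.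
   Context: The curve $\gamma$ is in fact defined by the same formula for all $t\in\mathbb R$. A curve is horizontal if it is absolutely continuous and $\dot\gamma(t)=u_1(t)f_1(\gamma(t))+u_2(t)f_2(\gamma(t))$ for a.e. $t$; the function $u=(u_1,u_2)$ is its control and its length is $\int|u(t)|\,dt$. A horizontal curve is length-minimizing if its length is minimal among all horizontal curves with the same end-points. ''Locally length-minimizing'' means that short enough sub-arcs of $\gamma$ are length-minimizing for fixed end-points. Strictly singular curves. Let $X=L^2([0,1];\mathbb R^2)$. For a fixed starting point $q$, the end-point map is $F:X\to\mathbb R^3$, $F(u)=\gamma_u(1)$, where $\gamma_u$ is the horizontal curve with control $u$ and $\gamma_u(0)=q$; the extended end-point map is $F_J:X\to\mathbb R^3\times\mathbb R$, $F_J(u)=(F(u),\frac12\|u\|^2_{L^2})$. A critical point $u$ of $F_J$ is strictly singular if every $(\lambda,\lambda_0)\in\mathrm{im}(d_uF_J)^\perp$ has $\lambda_0=0$. A horizontal curve is strictly singular if its control is.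
   Formalization: In (i), ''up to reparameterization'' means composing the line γ (all real t) with an absolutely continuous non-constant parameter change, strictly monotone when the curve is injective; monotonicity fails in general, since back-and-forth curves like (0,t(1−t),0) are also strictly singular. *)

(* Defs.v *)
From HB Require Import structures.
From mathcomp Require Import all_boot all_order all_algebra.
From mathcomp Require Import all_classical all_reals all_analysis.

Set Implicit Arguments.
Unset Strict Implicit.
Unset Printing Implicit Defensive.

Import Order.TTheory GRing.Theory Num.Theory.
Import numFieldNormedType.Exports.

Local Open Scope classical_set_scope.
Local Open Scope ring_scope.

Section AbsoluteContinuity.
Context {R : realType} {V : normedModType R}.

Definition abs_continuous (a b : R) (g : R -> V) : Prop :=
  forall e : R, 0 < e -> exists2 d : R, 0 < d &
    forall (m : nat) (s t : 'I_m -> R),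
      (forall i, [/\ a <= s i, s i <= t i & t i <= b]) ->
      trivIset [set: 'I_m] (fun i => `]s i, t i[%classic) ->
      \sum_(i < m) (t i - s i) < d ->
      \sum_(i < m) `|g (t i) - g (s i)| < e.

End AbsoluteContinuity.

Section Controls.
Context {R : realType}.

(* The library norm on row vectors is the sup norm; the metric making the frame
   orthonormal needs the Euclidean one. *)
Definition enorm (v : 'rV[R]_2) : R := Num.sqrt (\sum_(j < 2) v 0 j ^+ 2).

Definition measurable_control (a b : R) (u : R -> 'rV[R]_2) : Prop :=
  forall j, measurable_fun `[a, b] (fun t => u t 0 j).

(* Elements of L^2([0,1]; R^2) are represented by functions; their values
   outside [0,1] are irrelevant. *)
Definition L2_control (u : R -> 'rV[R]_2) : Prop :=
  measurable_control 0 1 u /\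
  lebesgue_measure.-integrable `[0, 1] (fun t => (enorm (u t) ^+ 2)%:E).

Definition L2_norm (u : R -> 'rV[R]_2) : R :=
  Num.sqrt (\int[lebesgue_measure]_(t in `[0, 1]) (enorm (u t) ^+ 2)).

(* [dG] is the Frechet differential at [u] of a map [G] on L^2([0,1]; R^2). *)
Definition is_L2_differential {V : normedModType R}
    (G : (R -> 'rV[R]_2) -> V) (u : R -> 'rV[R]_2)
    (dG : (R -> 'rV[R]_2) -> V) : Prop :=
  [/\ forall (c : R) v w, L2_control v -> L2_control w ->
        dG (c *: v + w) = c *: dG v + dG w,
      exists C : R, forall v, L2_control v -> `|dG v| <= C * L2_norm v &
      forall e : R, 0 < e -> exists2 d : R, 0 < d &
        forall v, L2_control v -> L2_norm v < d ->
          `|G (u + v) - G u - dG v| <= e * L2_norm v].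

End Controls.

(* [f] is the orthonormal frame of a rank-two sub-Riemannian structure on R^3. *)
Section SubRiemannian.
Context {R : realType} (f : 'I_2 -> 'rV[R]_3 -> 'rV[R]_3).

Definition horizontal (a b : R) (g : R -> 'rV[R]_3) (u : R -> 'rV[R]_2) : Prop :=
  [/\ abs_continuous a b g,
      measurable_control a b u &
      {ae lebesgue_measure, forall t : R, a <= t <= b ->
         is_derive t 1 g (\sum_(j < 2) u t 0 j *: f j (g t))}].

Definition control_length (a b : R) (u : R -> 'rV[R]_2) : \bar R :=
  \int[lebesgue_measure]_(t in `[a, b]) (enorm (u t))%:E.

Definition length_minimizing (a b : R) (g : R -> 'rV[R]_3) : Prop :=
  exists2 u, horizontal a b g u &
    forall (c d : R) (h : R -> 'rV[R]_3) (v : R -> 'rV[R]_2),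
      c <= d -> horizontal c d h v -> h c = g a -> h d = g b ->
      (control_length a b u <= control_length c d v)%E.

Definition locally_length_minimizing (a b : R) (g : R -> 'rV[R]_3) : Prop :=
  exists2 d : R, 0 < d &
    forall s t : R, a <= s -> s < t -> t <= b -> t - s < d ->
      length_minimizing s t g.

(* [get] returns an arbitrary point if no horizontal curve from [q] has
   control [u] on [0,1]. *)
Definition endpoint (q : 'rV[R]_3) (u : R -> 'rV[R]_2) : 'rV[R]_3 :=
  get [set p | exists g, [/\ horizontal 0 1 g u, g 0 = q & g 1 = p]].

Definition extended_endpoint (q : 'rV[R]_3) (u : R -> 'rV[R]_2) :
    'rV[R]_3 * R^o :=
  (endpoint q u, 2^-1 * L2_norm u ^+ 2).

Definition strictly_singular_control (q : 'rV[R]_3) (u : R -> 'rV[R]_2) : Prop :=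
  exists dFJ : (R -> 'rV[R]_2) -> 'rV[R]_3 * R^o,
    [/\ is_L2_differential (extended_endpoint q) u dFJ,
        ~ (forall w, exists2 v, L2_control v & dFJ v = w) &
        forall (l : 'rV[R]_3) (l0 : R),
          (forall v, L2_control v ->
             \sum_(i < 3) l 0 i * (dFJ v).1 0 i + l0 * (dFJ v).2 = 0) ->
          l0 = 0].

Definition strictly_singular (g : R -> 'rV[R]_3) : Prop :=
  exists u, [/\ L2_control u, horizontal 0 1 g u &
                strictly_singular_control (g 0) u].

End SubRiemannian.

Section Example.
Context {R : realType}.

Definition frame (n : nat) (j : 'I_2) (x : 'rV[R]_3) : 'rV[R]_3 :=
  if j == 0 then \row_(i < 3) [:: 1; 0; 0]`_i
  else \row_(i < 3) [:: 0; 1 - x 0 0; x 0 0 ^+ n]`_i.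

Definition gamma (t : R) : 'rV[R]_3 := \row_(i < 3) [:: 0; t; 0]`_i.

Definition through_origin (g : R -> 'rV[R]_3) : Prop :=
  exists2 t : R, 0 <= t <= 1 & g t = 0.

(* [g] on [0,1] is the reparameterization of [h] (defined on R) by [phi].
   The parameter change may run back and forth: t |-> (0, phi t, 0) is strictly
   singular even if phi is not monotone. *)
Definition reparameterization (g h : R -> 'rV[R]_3) (phi : R -> R) : Prop :=
  [/\ abs_continuous (V := R^o) 0 1 phi,
      exists s t : R, [/\ 0 <= s <= 1, 0 <= t <= 1 & phi s != phi t] &
      forall t : R, 0 <= t <= 1 -> g t = h (phi t)].

Definition strictly_monotone (phi : R -> R) : Prop :=
  {in `[0, 1] &, {homo phi : s t / s < t}} \/
  {in `[0, 1] &, {homo phi : s t /~ s < t}}.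

End Example.

(* Main.v *)
Require Import Defs.
From HB Require Import structures.
From mathcomp Require Import all_boot all_order all_algebra.
From mathcomp Require Import all_classical all_reals all_analysis.
From mathcomp Require Import measurable_realfun.
From mathcomp Require Import ring lra.

(** The structure is so explicit that no theory of differential equations is
needed: a horizontal curve with control u satisfies x1' = u1,
x2' = u2 (1 - x1), x3' = u2 x1^n, so it is obtained from u by three successive
integrations ([horizontal_integral], [hcurve], [endpoint_hcurve]).  What has
to be built is the fundamental theorem of calculus for absolutely continuous
functions ([ac_FTC]), which rests on the fact that such a function with
derivative 0 almost everywhere is constant ([ac_derive0_cst]).

Strictly singular curves.  Along gamma the differential of the extended
end-point map is computed by expanding the iterated integrals
([dgamma_differential]); its image misses the x3-direction, and testing a
covector against two controls shows that the covector has no energy component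
([gamma_strictly_singular]).  Conversely, let eta be strictly singular.  The
image of the differential is a proper subspace, so a nonzero covector kills
it, and strictness makes its energy component vanish
([singular_multiplier]).  Varying only the second component of the control
changes the end-point affinely, so the differential in these directions is
read off exactly ([dF_vertical]) and gives l1 (1 - x1) + l2 x1^n = 0 along
eta.  At the time when eta is at the origin this says l1 = 0, hence x1 = 0
throughout and eta stays in the x2-axis ([singular_on_axis]).  Were eta
constant, its control would vanish and the energy would be stationary,
against strictness ([singular_nonconstant]).

Even exponent.  Let h join the end-points of an arc of gamma of length T, with
control v and length L, and let A be the maximum of |x1| and E the integral
of |v| - v2.  Integrating d(x1^(n+1)) = (n+1) x1^n v1 up to the maximum, and
using that x1^n v2 has integral 0 with x1^n >= 0, one gets A <= (n+1) E
([even_excursion_bound]).  On the other hand v2 (1 - x1) has integral T, so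
E = L - T minus the integral of v2 x1, and E <= L - T + A L.  If L < T and
(n+1) T < 1 these two bounds contradict each other ([even_length_ge]).

Odd exponent.  Now x1^n takes both signs, so a curve of size d in the
x1-direction can gain length of order d while the x3-component returns to 0;
its extra cost is of order d^2.  Take x1 = d P with P odd, and a speed
v2 = S w with w chosen orthogonal to P^n but not to P; this is possible as P
and P^n are not proportional ([odd_weight], [odd_shorter_curve]). *)

Set Implicit Arguments.
Unset Strict Implicit.
Unset Printing Implicit Defensive.

Import Order.TTheory GRing.Theory Num.Theory.
Import numFieldNormedType.Exports.

Local Open Scope classical_set_scope.
Local Open Scope ring_scope.

(** * Absolutely continuous functions of one variable *)

(** Cover the exceptional null set by an open set U of measure less than the
    d given by absolute continuity for e.  Going from a to b by small steps, a
    step around a point outside U moves F by at most e times its length, and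
    a step around a point of U stays in U.  The latter steps, collected in a
    list, are disjoint and have total length less than d, so together they
    move F by less than e.  Completeness of R in the form of a supremum argument
    shows that finitely many steps reach b. *)
Lemma ac_derive0_cst (R : realType) (a b : R) (F : R -> R) : a <= b ->
  abs_continuous (V := R^o) a b F ->
  {ae lebesgue_measure, forall t : R, a <= t <= b -> is_derive t 1 F 0} ->
  F b = F a.
Proof.
move=> ab acF [B [mB B0 FB]].
apply/eqP; rewrite -subr_eq0 -normr_le0; apply/ler_addgt0Pl => e0' e0'0.
rewrite addr0.
pose e := e0' / (b - a + 1).
have c0 : 0 < b - a + 1 by rewrite ltr_wpDl// subr_ge0.
have e0 : 0 < e by rewrite divr_gt0.
suff : `|F b - F a| <= e * (b - a) + e.
  by rewrite -{2}(mulr1 e) -mulrDr divfK// gt_eqF.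
have [d d0 acd] := acF e e0.
have [U [oU BU Ud]] : exists U : set R, [/\ open U, B `<=` U &
    (lebesgue_measure U < d%:E)%E].
  have d20 : 0 < d / 2 by rewrite divr_gt0.
  have [U [oU BU Ud]] := outer_measure_open_le B d20.
  exists U; split => //; apply: le_lt_trans Ud _.
  rewrite [X in (X + _)%E](_ : _ = 0%E) ?add0e ?lte_fin; last first.
    by rewrite -[RHS]B0.
  by rewrite ltr_pdivrMr// mulr_natr mulr2n ltrDl.
pose inU t (p : R * R) := [/\ a <= p.1, p.1 <= p.2, p.2 <= t &
  `[p.1, p.2[ `<=` U].
pose Good t := exists l : seq (R * R), [/\ forall p, p \in l -> inU t p,
  pairwise (fun p q => q.2 <= p.1) l &
  `|F t - F a| <= e * (t - a) + \sum_(p <- l) `|F p.2 - F p.1|].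
(* The steps inside U are paid for by absolute continuity. *)
have Goodb : Good b -> `|F b - F a| <= e * (b - a) + e.
  move=> [l [lU lp]] /le_trans; apply; rewrite lerD2l; apply: ltW.
  pose m := size l.
  pose s (i : 'I_m) := (nth (0, 0) l i).1.
  pose t (i : 'I_m) := (nth (0, 0) l i).2.
  have lUi (i : 'I_m) : inU b (nth (0, 0) l i) by apply: lU; exact: mem_nth.
  have tst : trivIset [set: 'I_m] (fun i => `[s i, t i[%classic).
    have H (i j : 'I_m) : (i < j)%N -> t j <= s i.
      by move=> ij; move/(pairwiseP (0, 0)) : lp; apply => //; exact: ltn_ord.
    apply/trivIsetP => i j _ _ ij; apply/eqP/negPn/negP => /set0P[x []].
    rewrite /= !in_itv/= => /andP[six xti] /andP[sjx xtj].
    move: ij; rewrite neq_ltn => /orP[/H|/H] => h.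
      by have := lt_le_trans xtj (le_trans h six); rewrite ltxx.
    by have := lt_le_trans xti (le_trans h sjx); rewrite ltxx.
  have -> : \sum_(p <- l) `|F p.2 - F p.1| = \sum_(i < m) `|F (t i) - F (s i)|.
    by rewrite (big_nth (0, 0)) big_mkord.
  apply: (acd m s t).
  - by move=> i; have [] := lUi i.
  - apply/trivIsetP => i j _ _ ij.
    move/trivIsetP : tst => /(_ i j I I ij); apply: subsetI_eq0;
    by apply: subset_itvr; rewrite bnd_simp.
  rewrite -lte_fin (le_lt_trans _ Ud)//.
  rewrite -sumEFin (eq_bigr (fun i => lebesgue_measure `[s i, t i[%classic));
    last first.
    move=> i _; have [_ st _ _] := lUi i.
    rewrite lebesgue_measure_itv/= lte_fin.
    case: ltP => //; rewrite le_eqVlt => /predU1P[->|]; first by rewrite subrr.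
    by rewrite ltNge st.
  have -> : (\sum_(i < m) lebesgue_measure `[s i, t i[%classic =
      lebesgue_measure (\big[setU/set0]_(i < m) `[s i, t i[%classic))%E.
    by rewrite measure_bigsetU_ord.
  apply: le_measure; rewrite ?inE.
  - by apply: bigsetU_measurable => i _; exact: measurable_itv.
  - exact: open_measurable.
  - elim/big_ind: _ => // [X Y XU YU|i _]; first by rewrite subUset.
    by have [] := lUi i.
(* Any point s has a neighbourhood that a single step can cross. *)
have Goodext s : a <= s <= b -> exists2 r : R, 0 < r & forall t t',
    a <= t -> t <= s -> s <= t' -> t' <= b -> s - r < t -> t' < s + r ->
    Good t -> Good t'.
  move=> asb; have [Us|Us] := pselect (U s).
    have [r /= r0 rU] : exists2 r, 0 < r & ball s r `<=` U.
      have /nbhs_ballP[r /= r0 rU] : nbhs s U by exact: open_nbhs_nbhs.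
      by exists r.
    exists r => // t t' at_ ts st' t'b srt t'sr [l [lU lp lF]].
    exists ((t, t') :: l); split => [p||].
    - rewrite inE => /predU1P[->|/lU[? ? pt ?]].
        split => //=; first exact: le_trans st'.
        move=> x/=; rewrite in_itv/= => /andP[tx xt']; apply: rU.
        by rewrite /ball/= ltr_norml; lra.
      by split => //; rewrite (le_trans pt)// (le_trans ts).
    - rewrite /= lp andbT; apply/allP => p /lU[]//.
    - rewrite big_cons/= -(subrKA (F t)) (le_trans (ler_normD _ _))//.
      have : e * (t - a) <= e * (t' - a) by rewrite ler_pM2l//; lra.
      move: lF; lra.
  have F's : is_derive s 1 F 0.
    by apply: contrapT => h; apply: Us; apply/BU/FB => /(_ asb).
  have [r r0 rF] : exists2 r, 0 < r & forall x, `|x - s| < r ->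
      `|F x - F s| <= e * `|x - s|.
    have [/cvg_ex[l Fl] D0] := F's; have l0 : l = 0.
      by rewrite -D0; apply/esym/cvg_lim.
    move: Fl; rewrite l0 => /cvgr0Pnorm_le/(_ _ e0).
    move=> [r /= r0 rF]; exists r => // x xs.
    have [->|xs0] := eqVneq x s; first by rewrite !subrr normr0 mulr0.
    have := rF (x - s); rewrite /ball/= sub0r normrN subr_eq0 => /(_ xs xs0).
    rewrite [X in F (X + _)]mulr1 subrK normrM normfV.
    by rewrite ler_pdivrMl ?normr_gt0 ?subr_eq0// mulrC.
  exists r => // t t' at_ ts st' t'b srt t'sr [l [lU lp lF]].
  exists l; split => // [p /lU[? ? pt ?]|].
    by split => //; rewrite (le_trans pt)// (le_trans ts).
  have /rF : `|t - s| < r by rewrite ler0_norm; lra.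
  have /rF : `|t' - s| < r by rewrite ger0_norm; lra.
  rewrite (@ler0_norm _ (t - s)) ?(@ger0_norm _ (t' - s)) ?subr_le0 ?subr_ge0//.
  move: lF; rewrite !ler_norml => /andP[+ +] /andP[+ +] /andP[+ +].
  lra.
apply: Goodb.
pose S := [set t | a <= t <= b /\ Good t].
have Sa : S a.
  split; first by rewrite lexx.
  by exists [::]; split => //; rewrite big_nil !subrr normr0 mulr0 addr0.
have Sb : ubound S b by move=> t [/andP[]].
have supS : has_sup S by split; [exists a|exists b].
pose s := sup S.
have as_ : a <= s by apply: sup_upper_bound.
have sb : s <= b by apply: sup_le_ub => //; exists a.
have [|r r0 rG] := Goodext s; first by rewrite as_ sb.
have [t [/andP[at_ tb] Gt] srt] := sup_adherent r0 supS.
have ts : t <= s by apply: sup_upper_bound => //; rewrite /S/= at_ tb.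
have [t' st' [t'b t'sr]] : exists2 t', s <= t' &
    t' <= b /\ (t' < s + r /\ (s < b -> s < t')).
  have [sb'|sb'] := leP b s; first by exists s; lra.
  exists (Num.min b (s + r / 2)); first by rewrite le_min; lra.
  split; first by rewrite ge_min lexx.
  by split=> [|_]; rewrite ?gt_min ?lt_min; lra.
have Gt' : Good t' by apply: (rG t) => //; case: t'sr.
have st's : t' <= s.
  by apply: sup_upper_bound => //; split => //; rewrite t'b (le_trans as_).
have bs : b <= s.
  by rewrite leNgt; apply/negP => /t'sr.2; rewrite ltNge st's.
by have -> : b = t' by apply/eqP; rewrite eq_le; lra.
Qed.

Section Calculus.
Context {R : realType}.
Notation mu := (@lebesgue_measure R).
Implicit Types (a b s t : R) (f g h x F G : R -> R).

Lemma integrable_sub a b s t f : a <= s -> t <= b ->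
  mu.-integrable `[a, b] (EFin \o f) -> mu.-integrable `[s, t] (EFin \o f).
Proof.
move=> as_ tb; apply: integrableS => //.
by apply: subset_itv; rewrite bnd_simp.
Qed.

Lemma Rintegral_itv_diff a b s t f : mu.-integrable `[a, b] (EFin \o f) ->
  a <= s -> s <= t -> t <= b ->
  \int[mu]_(x in `[a, t]) f x - \int[mu]_(x in `[a, s]) f x =
  \int[mu]_(x in `[s, t]) f x.
Proof.
move=> fi as_ st tb.
rewrite Rintegral_itvB ?bnd_simp//; last by exact: integrable_sub fi.
rewrite Rintegral_itv_obnd_cbnd//.
apply: integrableS fi => //.
by apply: subset_itv; rewrite bnd_simp.
Qed.

Lemma ac_sub a b s t F : a <= s -> t <= b ->
  abs_continuous (V := R^o) a b F -> abs_continuous (V := R^o) s t F.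
Proof.
move=> as_ tb acF e /acF[d d0 ad]; exists d => // m p q pq.
apply: ad => i; have [? ? ?] := pq i.
by split => //; [exact: le_trans as_ _|exact: le_trans tb].
Qed.

(** Coordinates, powers and affine images of an absolutely continuous function
    all have increments bounded by a multiple of those of the function. *)
Lemma ac_lip (V W : normedModType R) a b (F : R -> V) (G : R -> W) (K : R) :
  (forall s t, a <= s -> s <= t -> t <= b ->
    `|G t - G s| <= K * `|F t - F s|) ->
  abs_continuous a b F -> abs_continuous a b G.
Proof.
move=> GF acF e e0.
have K0 : 0 < `|K| + 1 by rewrite ltr_wpDl.
have [d d0 ad] := acF (e / (`|K| + 1)) (divr_gt0 e0 K0).
exists d => // m p q pq pqt pqd.
have := ad m p q pq pqt pqd; rewrite ltr_pdivlMr//.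
apply: le_lt_trans; rewrite mulr_suml; apply: ler_sum => i _.
have [? ? ?] := pq i; rewrite (le_trans (GF _ _ _ _ _))// mulrC.
by rewrite ler_wpM2l// (le_trans (ler_norm _))// lerDl.
Qed.

Lemma acD (V : normedModType R) a b (F G : R -> V) :
  abs_continuous a b F -> abs_continuous a b G ->
  abs_continuous a b (fun t => F t + G t).
Proof.
move=> acF acG e e0; have e20 : 0 < e / 2 by rewrite divr_gt0.
have [d d0 ad] := acF _ e20; have [d' d'0 ad'] := acG _ e20.
exists (Num.min d d') => [|m p q pq pqt]; first by rewrite lt_min d0.
rewrite lt_min => /andP[pqd pqd'].
rewrite (splitr e).
apply: le_lt_trans (ltrD (ad m p q pq pqt pqd) (ad' m p q pq pqt pqd')).
rewrite -big_split/=; apply: ler_sum => i _.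
by rewrite opprD addrACA ler_normD.
Qed.

Lemma acB a b F G :
  abs_continuous (V := R^o) a b F -> abs_continuous (V := R^o) a b G ->
  abs_continuous (V := R^o) a b (fun t => F t - G t).
Proof.
move=> acF acG; apply: (acD acF); apply: (@ac_lip R^o R^o a b G _ 1) acG.
by move=> s t _ _ _; rewrite -opprD normrN mul1r.
Qed.

(** The integral of an integrable function over a set is small with the measure
    of the set; apply this to the union of the given intervals. *)
Lemma ac_Rintegral a b f : mu.-integrable `[a, b] (EFin \o f) ->
  abs_continuous (V := R^o) a b (fun t => \int[mu]_(x in `[a, t]) f x).
Proof.
move=> fi e e0.
pose g := f \_ `[a, b].
have gi : mu.-integrable setT (EFin \o g).
  by rewrite -restrict_EFin; apply/integrable_restrict => //=; rewrite setTI.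
have [d [d0 gd]] := integral_normr_continuous gi e0.
exists d => // m s t stab tst std.
have mst i : measurable `]s i, t i[%classic by exact: measurable_itv.
pose D := \big[setU/set0]_(i < m) `]s i, t i[%classic.
have mD : measurable D by exact: bigsetU_measurable.
have muD : (mu D < d%:E)%E.
  have -> : (mu D = \sum_(i < m) mu `]s i, t i[%classic)%E.
    by rewrite measure_bigsetU_ord.
  rewrite (eq_bigr (fun i => (t i - s i)%:E)) ?sumEFin ?lte_fin// => i _.
  have [_ st _] := stab i; rewrite lebesgue_measure_itv/= lte_fin.
  case: ltP => //; rewrite le_eqVlt => /predU1P[->|]; first by rewrite subrr.
  by rewrite ltNge st.
apply: le_lt_trans (gd D mD muD).
have -> : \int[mu]_(x in D) `|g x| =
    \sum_(i < m) \int[mu]_(x in `]s i, t i[) `|g x|.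
  rewrite /Rintegral ge0_integral_bigsetU//=.
  - rewrite sum_fine// => i _; apply: integrable_fin_num => //=.
    apply: (@integrableS _ _ _ _ setT) => //.
    exact: integrable_norm.
  - exact: index_enum_uniq.
  - exact: sub_trivIset tst.
  - apply/measurable_EFinP/measurableT_comp => //.
    apply: (@measurable_funS _ _ _ _ setT) => //.
    by move/measurable_int : gi => /measurable_EFinP.
apply: ler_sum => i _; have [as_ st tb] := stab i.
rewrite (Rintegral_itv_diff fi)//.
have fst : mu.-integrable `[s i, t i] (EFin \o f) by exact: integrable_sub fi.
rewrite (le_trans (le_normr_Rintegral _ fst))//.
have nfst := integrable_norm fst.
rewrite -(Rintegral_itv_obnd_cbnd) -?Rintegral_itv_bndo_bndc//.
- rewrite le_eqVlt; apply/orP; left; apply/eqP; apply: eq_Rintegral => x.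
  rewrite inE/= in_itv/= => /andP[sx xt]; rewrite /g patchE mem_set//=.
  by rewrite in_itv/= (le_trans as_ (ltW sx)) (le_trans (ltW xt) tb).
- by apply: integrableS nfst => //; apply: subset_itv; rewrite bnd_simp.
- by apply: integrableS nfst => //; apply: subset_itv; rewrite bnd_simp.
Qed.

Lemma ae_imply2 (P Q S : R -> Prop) : (forall t, P t -> Q t -> S t) ->
  {ae mu, forall t, P t} -> {ae mu, forall t, Q t} -> {ae mu, forall t, S t}.
Proof.
move=> PQS; apply: filterS2; first exact: (ae_filter_ringOfSetsType mu).
exact: PQS.
Qed.

Lemma ae_imply (P Q : R -> Prop) : (forall t, P t -> Q t) ->
  {ae mu, forall t, P t} -> {ae mu, forall t, Q t}.
Proof. by move=> PQ Pae; apply: (ae_imply2 _ Pae Pae) => t /PQ. Qed.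

Lemma ae_neq (b : R) : {ae mu, forall t, t != b}.
Proof.
exists [set b]; split; [exact: measurable_set1|exact: lebesgue_measure_set1|].
by move=> x /= /negP; rewrite negbK => /eqP.
Qed.

(** Lebesgue differentiation.  The derivative is two-sided, so the end-points
    of the interval join the exceptional set. *)
Lemma is_derive_Rintegral a b f : mu.-integrable `[a, b] (EFin \o f) ->
  {ae mu, forall t, a <= t <= b ->
    is_derive t 1 (fun t => \int[mu]_(x in `[a, t]) f x) (f t)}.
Proof.
move=> fi; pose g := f \_ `[a, b].
have gi : mu.-integrable setT (EFin \o g).
  by rewrite -restrict_EFin; apply/integrable_restrict => //=; rewrite setTI.
have locg : locally_integrable setT g.
  by apply: open_integrable_locally => //; exact: openT.
have ae_ab := ae_imply2 (fun t => @conj _ _) (ae_neq a) (ae_neq b).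
have := @FTC1 R g (BLeft a)
  (fun y => integrableS measurableT _ (@subsetT _ _) gi) locg.
move=> /(_ (fun y => measurable_itv _)).
apply: ae_imply2 ae_ab => t [ta tb] h /andP[at_ tb'].
have {}tb : t < b by rewrite lt_neqAle tb.
have [] := h; first by rewrite /= lte_fin lt_neqAle eq_sym ta.
clear h.
set G := (fun y : R => _); move=> dG G'.
have Gt : is_derive t 1 G (f t).
  apply: DeriveDef => //; rewrite -derive1E G' /g patchE mem_set//=.
  by rewrite in_itv/= at_ ltW.
apply: near_eq_is_derive Gt.
near=> x; apply: eq_Rintegral => y; rewrite inE/= in_itv/= => /andP[ay yx].
rewrite /g patchE mem_set//= in_itv/= ay (le_trans yx)//.
near: x; exists (b - t) => [|x /=]; rewrite /= ?subr_gt0// ltr_norml; lra.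
Unshelve. all: by end_near. Qed.

(** The difference of F and the integral of f is absolutely continuous with
    derivative 0 almost everywhere. *)
Lemma ac_FTC a b t f F : a <= t <= b ->
  abs_continuous (V := R^o) a b F -> mu.-integrable `[a, b] (EFin \o f) ->
  {ae mu, forall t, a <= t <= b -> is_derive t 1 F (f t)} ->
  F t - F a = \int[mu]_(x in `[a, t]) f x.
Proof.
move=> /andP[at_ tb] acF fi F'.
pose I t := \int[mu]_(x in `[a, t]) f x.
have : F t - I t = F a - I a.
  apply: (@ac_derive0_cst _ a t (fun t => F t - I t)) => //.
    apply: (@ac_sub a b a t) => //; apply: acB => //; exact: ac_Rintegral.
  apply: ae_imply2 F' (is_derive_Rintegral fi) => x Fx Ix /andP[ax xt].
  have axb : a <= x <= b by rewrite ax (le_trans xt).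
  rewrite -(subrr (f x)).
  exact: (is_deriveB (Fx axb) (Ix axb)).
rewrite /I set_itv1 Rintegral_set1 => /eqP.
by rewrite subr0 subr_eq => /eqP ->; rewrite addrC addKr.
Qed.

Lemma ac_continuous a b f : abs_continuous (V := R^o) a b f ->
  {within `[a, b], continuous f}.
Proof.
move=> acf; apply/subspace_continuousP => x; rewrite /= in_itv/= => /andP[ax xb].
apply/cvgrPdist_lt => e /acf[d d0 fd]; rewrite near_withinE.
exists d => //= y; rewrite /= in_itv/= => xyd /andP[ay yb].
have st2 (s t : R) : a <= s -> s <= t -> t <= b -> t - s < d -> `|f t - f s| < e.
  move=> as_ st tb tsd; have := fd 1%N (fun=> s) (fun=> t).
  rewrite !big_ord1; apply => //.
  by apply/trivIsetP => i j; rewrite !ord1 => _ _; rewrite eqxx.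
have [xy|/ltW yx] := leP x y.
  by rewrite distrC st2// -(ger0_norm (_ : 0 <= y - x)) ?subr_ge0// distrC.
by rewrite st2// -(ger0_norm (_ : 0 <= x - y)) ?subr_ge0.
Qed.

Lemma continuous_Rintegral a b f : mu.-integrable `[a, b] (EFin \o f) ->
  {within `[a, b], continuous (fun t => \int[mu]_(s in `[a, t]) f s)}.
Proof. by move=> fi; exact/ac_continuous/ac_Rintegral. Qed.

Lemma ac_id a b : abs_continuous (V := R^o) a b (@id R).
Proof.
move=> e e0; exists e => // m s t st _; apply: le_lt_trans; apply: ler_sum => i _.
by have [_ ? _] := st i; rewrite ger0_norm// subr_ge0.
Qed.

Lemma ac_cst a b (c : R) : abs_continuous (V := R^o) a b (cst c).
Proof.
move=> e e0; exists 1 => // m s t _ _ _.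
by rewrite big1// => i _; rewrite subrr normr0.
Qed.

Lemma ac_cstD a b (c : R) f : abs_continuous (V := R^o) a b f ->
  abs_continuous (V := R^o) a b (fun t => c + f t).
Proof.
apply: (@ac_lip _ _ _ _ _ _ 1) => s t _ _ _.
by rewrite opprD addrACA subrr add0r mul1r.
Qed.

Lemma within_cst_sub a b x : {within `[a, b], continuous x} ->
  {within `[a, b], continuous (fun s => 1 - x s)}.
Proof.
by move=> cx s; apply: continuousB; [exact: cst_continuous|exact: cx].
Qed.

Lemma within_exp a b x n : {within `[a, b], continuous x} ->
  {within `[a, b], continuous (fun s => x s ^+ n)}.
Proof.
move=> cx s.
apply: (@continuous_comp (subspace `[a, b]) R R x (fun y => y ^+ n)).
  exact: cx.
exact: exprn_continuous.
Qed.

Lemma within_measurable a b x : {within `[a, b], continuous x} ->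
  measurable_fun `[a, b] x.
Proof. by move=> cx; exact: subspace_continuous_measurable_fun. Qed.

Lemma within_bounded a b x : {within `[a, b], continuous x} ->
  exists M : R, forall t, a <= t <= b -> `|x t| <= M.
Proof.
move=> cx; have /compact_bounded[M [_ Mx]] : compact (x @` `[a, b]).
  by apply: continuous_compact => //; exact: segment_compact.
exists (M + 1) => t tab; apply: (Mx (M + 1)); first by rewrite ltrDl.
by exists t => //=; rewrite in_itv.
Qed.

(** From the factorization of x^(m+1) - y^(m+1) by x - y. *)
Lemma lip_exp (m : nat) (x y M : R) : `|x| <= M -> `|y| <= M ->
  `|x ^+ m.+1 - y ^+ m.+1| <= m.+1%:R * M ^+ m * `|x - y|.
Proof.
move=> xM yM; have M0 : 0 <= M by exact: le_trans xM.
rewrite subrXX normrM mulrC ler_wpM2r//.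
rewrite (le_trans (ler_norm_sum _ _ _))//.
rewrite (@le_trans _ _ (\sum_(i < m.+1) M ^+ m))//; last first.
  by rewrite sumr_const card_ord mulr_natl.
apply: ler_sum => -[i im] _ /=; rewrite normrM !normrX.
rewrite -{2}(subnK (ltnSE im)) exprD.
by rewrite ler_pM ?exprn_ge0// lerXn2r ?nnegrE.
Qed.

Lemma ac_exp (a b : R) (x : R -> R) m : abs_continuous (V := R^o) a b x ->
  abs_continuous (V := R^o) a b (fun t => x t ^+ m.+1).
Proof.
move=> acx; have [M xM] := within_bounded (ac_continuous acx).
apply: (@ac_lip _ _ _ _ _ _ (m.+1%:R * M ^+ m) _ acx) => s t as_ st tb.
by apply: lip_exp; apply: xM; lra.
Qed.

Lemma within_integrable (a b : R) (f : R -> R) :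
  {within `[a, b], continuous f} -> mu.-integrable `[a, b] (EFin \o f).
Proof. exact/continuous_compact_integrable/segment_compact. Qed.

Lemma continuous_integrable (a b : R) (f : R -> R) :
  continuous f -> mu.-integrable `[a, b] (EFin \o f).
Proof. by move=> cf; exact/within_integrable/continuous_subspaceT. Qed.

Lemma integrable_itv_cst a b (c : R) :
  mu.-integrable `[a, b] (EFin \o (fun=> c)).
Proof. by apply: continuous_integrable => ?; exact: cst_continuous. Qed.

Lemma Rintegral_itv_cst (a b c : R) : a <= b ->
  \int[mu]_(t in `[a, b]) c = c * (b - a).
Proof.
move=> ab; rewrite Rintegral_cst//= lebesgue_measure_itv/= lte_fin.
case: ltP => // ba; have -> : a = b by apply/eqP; rewrite eq_le ab.
by rewrite subrr.
Qed.

Lemma Rintegral_gt0 (a b c : R) (f : R -> R) : a < b ->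
  {within `[a, b], continuous f} -> (forall t, a <= t <= b -> 0 <= f t) ->
  a <= c <= b -> 0 < f c -> 0 < \int[mu]_(t in `[a, b]) f t.
Proof.
move=> ab cf f0 cab fc; have fi := within_integrable cf.
have fc2 : 0 < f c / 2 by rewrite divr_gt0.
have [d d0 df] : exists2 d : R, 0 < d & forall t, a <= t <= b -> `|c - t| < d ->
    f c / 2 <= f t.
  have /subspace_continuousP/(_ c) := cf; rewrite /= in_itv/= => /(_ cab).
  move/cvgrPdist_lt => /(_ _ fc2); rewrite near_withinE => -[d /= d0 df].
  exists d => // t tab ctd; have := df t ctd; rewrite /= in_itv/= => /(_ tab).
  rewrite ltr_norml => /andP[_ h]; have {}h : f c - f t < f c / 2 := h.
  by clear -h; lra.
have [s [t [as_ st tb stc]]] : exists s t, [/\ a <= s, s < t, t <= b &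
    forall r, s <= r <= t -> `|c - r| < d].
  exists (Num.max a (c - d / 2)), (Num.min b (c + d / 2)); split.
  - by rewrite le_max lexx.
  - rewrite lt_min !gt_max ab; lra.
  - by rewrite ge_min lexx.
  - move=> r; rewrite ge_max le_min ltr_norml => /andP[/andP[? ?] /andP[? ?]].
    by apply/andP; split; lra.
have -> : \int[mu]_(r in `[a, b]) f r = \int[mu]_(r in `[a, s]) f r +
    (\int[mu]_(r in `[s, t]) f r + \int[mu]_(r in `[t, b]) f r).
  rewrite -(Rintegral_itv_diff fi as_ (ltW st) tb).
  rewrite -(Rintegral_itv_diff fi (le_trans as_ (ltW st)) tb (lexx b)); ring.
have st0 : 0 < \int[mu]_(r in `[s, t]) f r.
  apply: (@lt_le_trans _ _ (\int[mu]_(r in `[s, t]) (f c / 2))).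
    by rewrite Rintegral_itv_cst ?ltW// mulr_gt0// subr_gt0.
  apply: le_Rintegral => //.
  - exact: integrable_itv_cst.
  - exact: integrable_sub fi.
  - move=> r; rewrite /= in_itv/= => rst; apply: df; last exact: stc.
    by case/andP: rst => *; apply/andP; split; lra.
rewrite ltr_wpDl// ?ltr_wpDr//; apply: Rintegral_ge0 => r;
  rewrite /= in_itv/= => /andP[? ?]; apply: f0; apply/andP; split; lra.
Qed.

Lemma integrable_mul_bounded a b f h (M : R) :
  mu.-integrable `[a, b] (EFin \o f) -> measurable_fun `[a, b] h ->
  (forall t, a <= t <= b -> `|h t| <= M) ->
  mu.-integrable `[a, b] (EFin \o (fun t => f t * h t)).
Proof.
move=> fi mh hM.
have := @integrableMl _ _ _ mu `[a, b]%classic (measurable_itv _)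
  (EFin \o f) h fi mh.
apply; exists M; split; first exact: num_real.
move=> K MK t; rewrite /= in_itv/= => /hM /le_trans; apply; exact: ltW.
Qed.

Lemma integrable_mul_cont a b f h :
  mu.-integrable `[a, b] (EFin \o f) -> {within `[a, b], continuous h} ->
  mu.-integrable `[a, b] (EFin \o (fun t => f t * h t)).
Proof.
move=> fi ch; have [M hM] := within_bounded ch.
by apply: integrable_mul_bounded hM => //; exact: within_measurable.
Qed.

End Calculus.

(** * Coordinates *)

Section Coordinates.
Context {R : realType}.
Notation mu := (@lebesgue_measure R).

Lemma sum2E (V : nmodType) (F : 'I_2 -> V) : \sum_(j < 2) F j = F 0 + F 1.
Proof.
by rewrite !big_ord_recl big_ord0 addr0; congr (_ + F _); apply: val_inj.
Qed.

Lemma sum3E (V : nmodType) (F : 'I_3 -> V) :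
  \sum_(j < 3) F j = F 0 + F 1 + F 2.
Proof.
rewrite !big_ord_recl big_ord0 addr0 addrA.
by congr (_ + F _ + F _); apply: val_inj.
Qed.

Lemma ord2P (P : 'I_2 -> Prop) : P 0 -> P 1 -> forall i, P i.
Proof.
move=> P0 P1 [[|[|//]] i].
- by move: P0; congr P; apply: val_inj.
- by move: P1; congr P; apply: val_inj.
Qed.

Lemma ord3P (P : 'I_3 -> Prop) : P 0 -> P 1 -> P 2 -> forall i, P i.
Proof.
move=> P0 P1 P2 [[|[|[|//]]] i].
- by move: P0; congr P; apply: val_inj.
- by move: P1; congr P; apply: val_inj.
- by move: P2; congr P; apply: val_inj.
Qed.

Definition vec3 (x y z : R) : 'rV[R]_3 := \row_(i < 3) [:: x; y; z]`_i.

Lemma vec3E x y z : (vec3 x y z 0 0 = x) * (vec3 x y z 0 1 = y) *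
  (vec3 x y z 0 2 = z).
Proof. by rewrite !mxE. Qed.

Lemma vec3_eta (p : 'rV[R]_3) : p = vec3 (p 0 0) (p 0 1) (p 0 2).
Proof. by apply/rowP; apply: ord3P; rewrite vec3E. Qed.

Definition vec2 (x y : R) : 'rV[R]_2 := \row_(i < 2) [:: x; y]`_i.

Lemma vec2E x y : (vec2 x y 0 0 = x) * (vec2 x y 0 1 = y).
Proof. by rewrite !mxE. Qed.

Lemma frame_vec3 n (c : 'rV[R]_2) (p : 'rV[R]_3) :
  \sum_(j < 2) c 0 j *: frame n j p =
  vec3 (c 0 0) (c 0 1 * (1 - p 0 0)) (c 0 1 * p 0 0 ^+ n).
Proof.
rewrite sum2E /frame /=; apply/rowP; apply: ord3P; rewrite vec3E !mxE /=; ring.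
Qed.

Lemma ler_coord m n (v : 'M[R]_(m.+1, n.+1)) i j : `|v i j| <= `|v|.
Proof.
rewrite [leRHS]/Num.Def.normr/= mx_normrE.
exact: (@le_bigmax _ _ _ 0 (fun ij : 'I__ * 'I__ => `|v ij.1 ij.2|) (i, j)).
Qed.

Lemma norm_vec3 (x y z : R) : `|vec3 x y z| <= `|x| + `|y| + `|z|.
Proof.
rewrite [leLHS]/Num.Def.normr/= mx_normrE; apply: bigmax_le => [|[i j] _].
  by rewrite !addr_ge0.
rewrite ord1 /=; elim/ord3P: j; rewrite vec3E.
- by rewrite -addrA lerDl addr_ge0.
- by rewrite addrAC lerDr addr_ge0.
- by rewrite lerDr addr_ge0.
Qed.

Lemma is_derive_coord (g : R -> 'rV[R]_3) (t : R) (w : 'rV[R]_3) i :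
  is_derive t 1 g w -> is_derive t 1 (fun s => g s 0 i) (w 0 i).
Proof.
move=> [dg <-]; apply: DeriveDef; first by move/derivable_mxP: dg; apply.
by rewrite derive_mx// mxE.
Qed.

Lemma is_derive_vec3 (x y z : R -> R) (t x' y' z' : R) :
  is_derive t 1 x x' -> is_derive t 1 y y' -> is_derive t 1 z z' ->
  is_derive t 1 (fun s => vec3 (x s) (y s) (z s)) (vec3 x' y' z').
Proof.
move=> dx dy dz.
have xE : (fun s => vec3 (x s) (y s) (z s) 0 0) = x.
  by apply/funext => s; rewrite vec3E.
have yE : (fun s => vec3 (x s) (y s) (z s) 0 1) = y.
  by apply/funext => s; rewrite vec3E.
have zE : (fun s => vec3 (x s) (y s) (z s) 0 2) = z.
  by apply/funext => s; rewrite vec3E.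
have dv : derivable (fun s => vec3 (x s) (y s) (z s)) t 1.
  apply/derivable_mxP => i; rewrite ord1; apply: ord3P.
  - by rewrite xE; exact: ex_derive.
  - by rewrite yE; exact: ex_derive.
  - by rewrite zE; exact: ex_derive.
apply: DeriveDef => //; rewrite derive_mx//.
apply/rowP; apply: ord3P; rewrite mxE vec3E.
- by rewrite xE; exact: derive_val.
- by rewrite yE; exact: derive_val.
- by rewrite zE; exact: derive_val.
Qed.

Lemma ac_coord (a b : R) (g : R -> 'rV[R]_3) i :
  abs_continuous a b g -> abs_continuous (V := R^o) a b (fun s => g s 0 i).
Proof.
apply: (@ac_lip _ _ _ _ _ _ _ 1) => s t _ _ _; rewrite mul1r.
by have := ler_coord (g t - g s) 0 i; rewrite !mxE.
Qed.

Lemma ac_vec3 (a b : R) (x y z : R -> R) :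
  abs_continuous (V := R^o) a b x -> abs_continuous (V := R^o) a b y ->
  abs_continuous (V := R^o) a b z ->
  abs_continuous a b (fun s => vec3 (x s) (y s) (z s)).
Proof.
move=> acx acy acz.
have -> : (fun s => vec3 (x s) (y s) (z s)) =
    (fun s => vec3 (x s) 0 0 + vec3 0 (y s) 0 + vec3 0 0 (z s)).
  by apply/funext => s; apply/rowP; apply: ord3P; rewrite !mxE/=; ring.
apply: acD; first apply: acD.
- apply: (@ac_lip _ _ _ _ _ _ _ 1 _ acx) => s t _ _ _; rewrite mul1r.
  have -> : vec3 (x t) 0 0 - vec3 (x s) 0 0 = vec3 (x t - x s) 0 0.
    by apply/rowP; apply: ord3P; rewrite !mxE/=; ring.
  by rewrite (le_trans (norm_vec3 _ _ _))// normr0 !addr0.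
- apply: (@ac_lip _ _ _ _ _ _ _ 1 _ acy) => s t _ _ _; rewrite mul1r.
  have -> : vec3 0 (y t) 0 - vec3 0 (y s) 0 = vec3 0 (y t - y s) 0.
    by apply/rowP; apply: ord3P; rewrite !mxE/=; ring.
  by rewrite (le_trans (norm_vec3 _ _ _))// normr0 add0r addr0.
- apply: (@ac_lip _ _ _ _ _ _ _ 1 _ acz) => s t _ _ _; rewrite mul1r.
  have -> : vec3 0 0 (z t) - vec3 0 0 (z s) = vec3 0 0 (z t - z s).
    by apply/rowP; apply: ord3P; rewrite !mxE/=; ring.
  by rewrite (le_trans (norm_vec3 _ _ _))// normr0 !add0r.
Qed.

End Coordinates.

(** * Horizontal curves are iterated integrals of their control *)

Section HorizontalCurves.
Context {R : realType}.
Notation mu := (@lebesgue_measure R).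
Implicit Types (a b s t : R) (f h x : R -> R) (u v w : R -> 'rV[R]_2).

Definition integrable_control a b u :=
  forall j, mu.-integrable `[a, b] (EFin \o (fun t => u t 0 j)).

Lemma integrable_controlD a b v w : integrable_control a b v ->
  integrable_control a b w -> integrable_control a b (v + w).
Proof.
move=> iv iw j.
have : mu.-integrable `[a, b] (EFin \o (fun t => v t 0 j + w t 0 j)).
  exact: (integrableD _ (iv j) (iw j)).
by apply: eq_integrable => // t _ /=; rewrite mxE.
Qed.

Lemma le_integrable_control a b c v : b <= c ->
  integrable_control a c v -> integrable_control a b v.
Proof. by move=> bc iv j; apply: integrable_sub (iv j). Qed.

(** The fundamental theorem of calculus in each coordinate; the integrands of
    the last two are integrable because x1 is continuous. *)
Lemma horizontal_integral n a b t g u : horizontal (frame n) a b g u ->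
  integrable_control a b u -> a <= t <= b ->
  [/\ g t 0 0 = g a 0 0 + \int[mu]_(s in `[a, t]) (u s 0 0),
      g t 0 1 = g a 0 1 + \int[mu]_(s in `[a, t]) (u s 0 1 * (1 - g s 0 0)) &
      g t 0 2 = g a 0 2 + \int[mu]_(s in `[a, t]) (u s 0 1 * g s 0 0 ^+ n)].
Proof.
move=> [acg mug dg] iu tab.
have cg : {within `[a, b], continuous (fun s => g s 0 0)}.
  exact/ac_continuous/ac_coord.
have FTC i (f : R -> R) : mu.-integrable `[a, b] (EFin \o f) ->
    (forall s, f s = (\sum_(j < 2) u s 0 j *: frame n j (g s)) 0 i) ->
    g t 0 i = g a 0 i + \int[mu]_(s in `[a, t]) f s.
  move=> fi fE; apply/eqP; rewrite addrC -subr_eq; apply/eqP.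
  apply: (@ac_FTC _ a b t f (fun s => g s 0 i)) => //; first exact: ac_coord.
  apply: (ae_imply _ dg) => s ds /ds {}ds.
  by rewrite fE; exact: is_derive_coord.
split; apply: FTC => [|s].
- exact: iu.
- by rewrite frame_vec3 vec3E.
- apply: integrable_mul_cont; [exact: iu|exact: within_cst_sub].
- by rewrite frame_vec3 vec3E.
- apply: integrable_mul_cont; [exact: iu|exact: within_exp].
- by rewrite frame_vec3 vec3E.
Qed.

(** The right-hand sides of [horizontal_integral] with x1 replaced by its own
    formula: the solution from q of the control equation, in closed form. *)
Definition hcurve n a (q : 'rV[R]_3) u t : 'rV[R]_3 :=
  let x t := q 0 0 + \int[mu]_(s in `[a, t]) (u s 0 0) in
  vec3 (x t) (q 0 1 + \int[mu]_(s in `[a, t]) (u s 0 1 * (1 - x s)))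
    (q 0 2 + \int[mu]_(s in `[a, t]) (u s 0 1 * x s ^+ n)).

Lemma hcurveE n a (q : 'rV[R]_3) u t :
  let x t := q 0 0 + \int[mu]_(s in `[a, t]) (u s 0 0) in
  [/\ hcurve n a q u t 0 0 = x t,
    hcurve n a q u t 0 1 =
      q 0 1 + \int[mu]_(s in `[a, t]) (u s 0 1 * (1 - x s)) &
    hcurve n a q u t 0 2 =
      q 0 2 + \int[mu]_(s in `[a, t]) (u s 0 1 * x s ^+ n)].
Proof. by rewrite /hcurve; split; rewrite vec3E. Qed.

Lemma hcurve_start n a q u : hcurve n a q u a = q.
Proof.
by rewrite [RHS]vec3_eta /hcurve set_itv1 !Rintegral_set1 !addr0.
Qed.

Lemma horizontal_unique n a b t g u : horizontal (frame n) a b g u ->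
  integrable_control a b u -> a <= t <= b -> g t = hcurve n a (g a) u t.
Proof.
move=> hg iu tab; have := horizontal_integral hg iu.
move=> hI; rewrite (vec3_eta (g t)) /hcurve.
have [-> -> ->] := hI t tab.
congr vec3; congr (_ + _); apply: eq_Rintegral => s;
  rewrite inE/= in_itv/= => /andP[as_ st];
  have [|-> _ _//] := hI s; rewrite as_ (le_trans st)//; by case/andP: tab.
Qed.

(** Existence for the control equation, for every integrable control. *)
Lemma horizontal_hcurve n a b q u : integrable_control a b u ->
  horizontal (frame n) a b (hcurve n a q u) u.
Proof.
move=> iu.
pose x t := q 0 0 + \int[mu]_(s in `[a, t]) (u s 0 0).
have acx : abs_continuous (V := R^o) a b x by exact/ac_cstD/ac_Rintegral/iu.
have cx := ac_continuous acx.
have iy : mu.-integrable `[a, b] (EFin \o (fun s => u s 0 1 * (1 - x s))).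
  apply: integrable_mul_cont; [exact: iu|exact: within_cst_sub].
have iz : mu.-integrable `[a, b] (EFin \o (fun s => u s 0 1 * x s ^+ n)).
  apply: integrable_mul_cont; [exact: iu|exact: within_exp].
split.
- by apply: ac_vec3 => //; exact/ac_cstD/ac_Rintegral.
- by move=> j; have /measurable_int/measurable_EFinP := iu j.
- have dI (f : R -> R) (c : R) : mu.-integrable `[a, b] (EFin \o f) ->
      {ae mu, forall t, a <= t <= b ->
        is_derive t 1 (fun t => c + \int[mu]_(s in `[a, t]) f s) (f t)}.
    move=> fi; apply: ae_imply (is_derive_Rintegral fi).
    move=> t ft /ft {}ft; rewrite -[X in is_derive _ _ _ X]add0r.
    exact: is_deriveD.
  apply: (ae_imply2 _ (dI _ (q 0 0) (iu 0))
    (ae_imply2 (fun t => @conj _ _) (dI _ (q 0 1) iy) (dI _ (q 0 2) iz))).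
  move=> t dx [dy dz] tab; rewrite frame_vec3 /hcurve !vec3E.
  exact: is_derive_vec3 (dx tab) (dy tab) (dz tab).
Qed.

(** Existence and uniqueness make [get] select the closed-form solution. *)
Lemma endpoint_hcurve n q u : integrable_control 0 1 u ->
  endpoint (frame n) q u = hcurve n 0 q u 1.
Proof.
move=> iu; apply: get_unique => [|p [g [hg <- <-]]].
  exists (hcurve n 0 q u); split => //; last exact: hcurve_start.
  exact: horizontal_hcurve.
by apply: (horizontal_unique hg iu); rewrite ler01 lexx.
Qed.

End HorizontalCurves.

(** * Length of controls *)

Section Length.
Context {R : realType}.
Notation mu := (@lebesgue_measure R).
Implicit Types (a b s t : R) (u : R -> 'rV[R]_2) (v : 'rV[R]_2).

Lemma enorm_ge0 v : 0 <= enorm v. Proof. exact: sqrtr_ge0. Qed.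

Lemma enorm_sqr v : enorm v ^+ 2 = v 0 0 ^+ 2 + v 0 1 ^+ 2.
Proof. by rewrite /enorm sum2E sqr_sqrtr// addr_ge0 ?sqr_ge0. Qed.

Lemma le_enorm v c : 0 <= c ->
  v 0 0 ^+ 2 + v 0 1 ^+ 2 <= c ^+ 2 -> enorm v <= c.
Proof.
by move=> c0; rewrite -enorm_sqr ler_sqr// nnegrE enorm_ge0.
Qed.

(** This is what turns integrability of the length element into integrability
    of the two components of a control. *)
Lemma enorm_ge_coord v (j : 'I_2) : `|v 0 j| <= enorm v.
Proof.
rewrite -(ler_sqr (normr_ge0 _) (enorm_ge0 _)) real_normK ?num_real//.
rewrite enorm_sqr.
by elim/ord2P: j; rewrite ?lerDl ?lerDr sqr_ge0.
Qed.

Lemma enorm_le_sum v : enorm v <= `|v 0 0| + `|v 0 1|.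
Proof.
apply: le_enorm; first by rewrite addr_ge0.
rewrite sqrrD !real_normK ?num_real// -addrA lerD2l lerDr.
by rewrite mulrn_wge0// mulr_ge0.
Qed.

Lemma measurable_enorm a b u : measurable_control a b u ->
  measurable_fun `[a, b] (fun t => enorm (u t)).
Proof.
move=> mu_.
have -> : (fun t => enorm (u t)) =
    Num.sqrt \o (fun t => u t 0 0 ^+ 2 + u t 0 1 ^+ 2).
  by apply/funext => t; rewrite /enorm sum2E.
apply: measurableT_comp.
  apply: continuous_measurable_fun; exact: sqrt_continuous.
by apply: measurable_funD; apply: measurable_funX; apply: mu_.
Qed.

Lemma integrable_control_measurable a b u :
  integrable_control a b u -> measurable_control a b u.
Proof. by move=> iu j; have /measurable_int/measurable_EFinP := iu j. Qed.

Lemma integrable_enorm a b u : integrable_control a b u ->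
  mu.-integrable `[a, b] (EFin \o (fun t => enorm (u t))).
Proof.
move=> iu; have i0 := integrable_norm (iu 0); have i1 := integrable_norm (iu 1).
have i01 : mu.-integrable `[a, b]
    (EFin \o (fun t => `|u t 0 0| + `|u t 0 1|)).
  exact: (integrableD _ i0 i1).
move: i01.
apply: le_integrable => //.
  by apply/measurable_EFinP; apply: measurable_enorm;
    exact: integrable_control_measurable.
move=> t _ /=; rewrite lee_fin (ger0_norm (enorm_ge0 _)) ger0_norm ?addr_ge0//.
exact: enorm_le_sum.
Qed.

Lemma control_lengthE a b u : integrable_control a b u ->
  control_length a b u = (\int[mu]_(t in `[a, b]) enorm (u t))%:E.
Proof.
move=> iu; rewrite /control_length /Rintegral fineK//.
by apply: integrable_fin_num => //; exact: integrable_enorm.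
Qed.

(** A competitor of infinite length is harmless, and one of finite length has an
    integrable control, to which the integral formulas apply. *)
Lemma control_length_finite a b u : measurable_control a b u ->
  (control_length a b u < +oo)%E -> integrable_control a b u.
Proof.
move=> mu_ uoo j.
have : mu.-integrable `[a, b] (EFin \o (fun t => enorm (u t))).
  apply/integrableP; split; first by apply/measurable_EFinP; exact: measurable_enorm.
  apply: le_lt_trans uoo; rewrite /control_length le_eqVlt; apply/orP; left.
  by apply/eqP/eq_integral => t _; rewrite gee0_abs// lee_fin enorm_ge0.
apply: le_integrable => //; first by apply/measurable_EFinP; exact: mu_.
move=> t _ /=; rewrite lee_fin (ger0_norm (enorm_ge0 _)).
exact: enorm_ge_coord.
Qed.

Lemma length_cst a b v : a <= b ->
  control_length a b (fun=> v) = (enorm v * (b - a))%:E.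
Proof.
move=> ab; rewrite /control_length integral_cst//= lebesgue_measure_itv/= lte_fin.
case: ltP => // ba.
have -> : a = b by apply/eqP; rewrite eq_le ab.
by rewrite subrr mulr0 mule0.
Qed.

Lemma enorm_vec2_01 : enorm (vec2 0 1) = 1 :> R.
Proof. by rewrite /enorm sum2E !vec2E expr0n add0r expr1n sqrtr1. Qed.

Lemma horizontal_gamma n a b : (0 < n)%N ->
  horizontal (frame n) a b (@gamma R) (fun=> vec2 0 1).
Proof.
move=> n0; split.
- by apply: ac_vec3; [exact: ac_cst|exact: ac_id|exact: ac_cst].
- by move=> j; exact: measurable_cst.
- apply: aeW => t _; rewrite frame_vec3 !vec2E !mxE/= expr0n eqn0Ngt n0.
  rewrite subr0 !mulr1 mulr0.
  by apply: is_derive_vec3.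
Qed.

End Length.

(** * Even exponent: short arcs are minimizing *)

Section EvenExponent.
Context {R : realType}.
Notation mu := (@lebesgue_measure R).

(** With x = x1, the change of x^(n+1) up to a point where |x| = A is
    (n+1) times an integral of x^n v1, hence A^(n+1) is at most (n+1) times the
    integral of x^n |v|.  As x^n v2 has integral 0, this is the integral of
    x^n (|v| - v2), in which both factors are nonnegative because n is even, so
    x^n may be replaced by its maximum A^n. *)
Lemma even_excursion_bound n (c d : R) h v (A : R) :
  ~~ odd n -> c <= d -> horizontal (frame n) c d h v ->
  integrable_control c d v -> h c 0 0 = 0 ->
  \int[mu]_(s in `[c, d]) (v s 0 1 * h s 0 0 ^+ n) = 0 ->
  (forall t, c <= t <= d -> `|h t 0 0| <= A) ->
  (exists2 t, c <= t <= d & `|h t 0 0| = A) ->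
  A <= n.+1%:R * \int[mu]_(s in `[c, d]) (enorm (v s) - v s 0 1).
Proof.
move=> ne cd hv iv hc0 z0 hA [t /andP[ct td] htA].
pose x s := h s 0 0.
have A0 : 0 <= A by rewrite -htA.
have ien := integrable_enorm iv.
have xn0 s : 0 <= x s ^+ n by rewrite exprn_even_ge0.
have acx : abs_continuous (V := R^o) c d x by case: hv => ? _ _; exact: ac_coord.
have cxn : {within `[c, d], continuous (fun s => x s ^+ n)}.
  exact/within_exp/ac_continuous.
have idf : mu.-integrable `[c, d] (EFin \o (fun s => enorm (v s) - v s 0 1)).
  by apply: (integrableB _ ien (iv 1)).
have idf0 : 0 <= \int[mu]_(s in `[c, d]) (enorm (v s) - v s 0 1).
  apply: Rintegral_ge0 => s _; rewrite subr_ge0.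
  by rewrite (le_trans (ler_norm _))// enorm_ge_coord.
have [A0'|A_neq0] := eqVneq A 0; first by rewrite A0' mulr_ge0.
have {}A0 : 0 < A by rewrite lt_neqAle eq_sym A_neq0.
have ixe : mu.-integrable `[c, d] (EFin \o (fun s => enorm (v s) * x s ^+ n)).
  exact: integrable_mul_cont.
have ixv : mu.-integrable `[c, d] (EFin \o (fun s => v s 0 1 * x s ^+ n)).
  by apply: integrable_mul_cont => //; exact: iv.
have ixd : mu.-integrable `[c, d] (EFin \o (fun s => v s 0 0 * x s ^+ n)).
  by apply: integrable_mul_cont => //; exact: iv.
have ixd' : mu.-integrable `[c, d]
    (EFin \o (fun s => n.+1%:R * (v s 0 0 * x s ^+ n))).
  exact: (integrableZl _ _ ixd).
have FTC : x t ^+ n.+1 - x c ^+ n.+1 =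
    \int[mu]_(s in `[c, t]) (n.+1%:R * (v s 0 0 * x s ^+ n)).
  apply: (@ac_FTC _ c d t _ (fun s => x s ^+ n.+1)) => //; first by rewrite ct.
    exact: ac_exp.
  case: hv => _ _ dh; apply: (ae_imply _ dh) => s ds /ds {}ds.
  have dx : is_derive s 1 x (v s 0 0).
    by have := is_derive_coord 0 ds; rewrite frame_vec3 vec3E.
  have := is_deriveX n.+1 dx; rewrite exprfctE.
  move=> /is_derive_eq; apply; rewrite /= /GRing.scale/=; ring.
have {FTC} : A ^+ n.+1 <=
    n.+1%:R * \int[mu]_(s in `[c, d]) (enorm (v s) * x s ^+ n).
  rewrite -htA -normrX -/(x t) -[x t ^+ n.+1]subr0 -[X in _ - X](expr0n _ n.+1).
  rewrite -hc0 FTC.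
  rewrite RintegralZl//; last exact: integrable_sub ixd.
  rewrite normrM ger0_norm// ler_wpM2l//.
  rewrite (le_trans (le_normr_Rintegral _ _))//; first exact: integrable_sub ixd.
  have [iL iR] :
      mu.-integrable `[c, t] (EFin \o (fun s => `|v s 0 0 * x s ^+ n|)) /\
      mu.-integrable `[c, t] (EFin \o (fun s => enorm (v s) * x s ^+ n)).
    split; last exact: integrable_sub ixe.
    exact/integrable_norm/(integrable_sub _ _ ixd).
  apply: (@le_trans _ _ (\int[mu]_(s in `[c, t]) (enorm (v s) * x s ^+ n))).
    apply: le_Rintegral => // s _.
    by rewrite normrM (ger0_norm (xn0 s)) ler_wpM2r// enorm_ge_coord.
  rewrite -subr_ge0 (Rintegral_itv_diff ixe)//.
  by apply: Rintegral_ge0 => s _; rewrite mulr_ge0// enorm_ge0.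
have -> : \int[mu]_(s in `[c, d]) (enorm (v s) * x s ^+ n) =
    \int[mu]_(s in `[c, d]) ((enorm (v s) - v s 0 1) * x s ^+ n).
  rewrite -[LHS]subr0 -z0 -RintegralB//.
  by apply: eq_Rintegral => s _; rewrite mulrBl.
have : \int[mu]_(s in `[c, d]) ((enorm (v s) - v s 0 1) * x s ^+ n) <=
    \int[mu]_(s in `[c, d]) ((enorm (v s) - v s 0 1) * A ^+ n).
  apply: le_Rintegral => //.
  - exact: integrable_mul_cont.
  - apply: integrable_mul_cont => // s; exact: cst_continuous.
  - move=> s; rewrite /= in_itv/= => scd; rewrite ler_wpM2l ?subr_ge0//.
      by rewrite (le_trans (ler_norm _))// enorm_ge_coord.
    rewrite -(ger0_norm (xn0 s)) normrX lerXn2r ?nnegrE ?(ltW A0)//.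
    exact: hA.
rewrite RintegralZr// => le1 le2.
rewrite -(@ler_pM2r _ (A ^+ n)) ?exprn_gt0// -exprS (le_trans le2)//.
by rewrite -mulrA ler_wpM2l.
Qed.

(** Drifting to the side lets a curve advance along x2 faster than its
    length, but by at most A L; and reaching A costs at least A / (n+1) by
    [even_excursion_bound].  For short arcs the cost exceeds the gain. *)
Lemma even_length_ge n (s t c d : R) h v : ~~ odd n ->
  s < t -> (t - s) * n.+1%:R < 1 -> c <= d -> horizontal (frame n) c d h v ->
  h c = gamma s -> h d = gamma t -> ((t - s)%:E <= control_length c d v)%E.
Proof.
move=> ne st tsn cd hv hc hd.
have [Loo|Lfin] := leP +oo%E (control_length c d v).
  by apply: le_trans Loo; rewrite leey.
have iv : integrable_control c d v.
  by apply: control_length_finite Lfin; case: hv.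
rewrite control_lengthE// lee_fin leNgt; apply/negP.
set L := \int[mu]_(_ in _) _ => LT.
have [xd yd zd] : [/\ h d 0 0 = h c 0 0 + \int[mu]_(s in `[c, d]) (v s 0 0),
      h d 0 1 = h c 0 1 + \int[mu]_(s in `[c, d]) (v s 0 1 * (1 - h s 0 0)) &
      h d 0 2 = h c 0 2 + \int[mu]_(s in `[c, d]) (v s 0 1 * h s 0 0 ^+ n)].
  by apply: (horizontal_integral hv iv); rewrite cd lexx.
have x0 : h c 0 0 = 0 by rewrite hc mxE.
have {}zd : \int[mu]_(s in `[c, d]) (v s 0 1 * h s 0 0 ^+ n) = 0.
  by move: zd; rewrite hc hd !mxE/= add0r.
have {}yd : \int[mu]_(s in `[c, d]) (v s 0 1 * (1 - h s 0 0)) = t - s.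
  by move: yd; rewrite hc hd !mxE/= => ->; rewrite addrC addKr.
have cx : {within `[c, d], continuous (fun s => h s 0 0)}.
  by case: hv => ? _ _; exact/ac_continuous/ac_coord.
have cnx : {within `[c, d], continuous (fun s => `|h s 0 0|)}.
  move=> r; apply: (@continuous_comp (subspace `[c, d]) R R (fun s => h s 0 0)).
    exact: cx.
  exact: norm_continuous.
(* A is the maximum of |x1|, attained at r. *)
have [r rcd hr] := EVT_max cd cnx.
have {}rcd : c <= r <= d by move: rcd; rewrite in_itv.
pose A := `|h r 0 0|.
have hA p : c <= p <= d -> `|h p 0 0| <= A by move=> cpd; apply: hr; rewrite in_itv.
have bnd := even_excursion_bound ne cd hv iv x0 zd hA (ex_intro2 _ _ r rcd erefl).
have ien := integrable_enorm iv.
have ivx : mu.-integrable `[c, d] (EFin \o (fun s => v s 0 1 * h s 0 0)).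
  by apply: integrable_mul_cont => //; exact: iv.
have e0 : 0 <= \int[mu]_(s in `[c, d]) (enorm (v s) - v s 0 1).
  apply: Rintegral_ge0 => p _; rewrite subr_ge0.
  by rewrite (le_trans (ler_norm _))// enorm_ge_coord.
have iv1 := iv 1.
move: bnd e0; rewrite (RintegralB _ ien iv1)//.
rewrite -/L; set V := \int[mu]_(s in `[c, d]) (v s 0 1).
have -> : V = t - s + \int[mu]_(s in `[c, d]) (v s 0 1 * h s 0 0).
  rewrite -yd -RintegralD//; last first.
    apply: integrable_mul_cont; [exact: iv|exact: within_cst_sub].
  by apply: eq_Rintegral => p _; ring.
have : `|\int[mu]_(s in `[c, d]) (v s 0 1 * h s 0 0)| <= L * A.
  rewrite (le_trans (le_normr_Rintegral _ _))// -RintegralZr//.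
  apply: le_Rintegral => //.
  - exact: integrable_norm.
  - apply: integrable_mul_cont => // p; exact: cst_continuous.
  - move=> p; rewrite /= in_itv/= => pcd; rewrite normrM ler_pM//.
      exact: enorm_ge_coord.
    exact: hA.
set W := \int[mu]_(_ in _) _; rewrite ler_norml => /andP[WL _] An e0.
have L0 : 0 <= L by apply: Rintegral_ge0 => p _; exact: enorm_ge0.
have n0 : 0 <= n.+1%:R :> R by [].
(* E is the integral of |v| - v2: cost E, gain - W at most L A. *)
set E := L - (t - s + W) in An e0.
have E1 : E < L * A by rewrite /E; lra.
have E2 : L * A <= L * (n.+1%:R * E) by rewrite ler_wpM2l.
have E3 : L * n.+1%:R <= 1.
  by rewrite ltW// (le_lt_trans _ tsn)// ler_wpM2r// ltW.
have := ler_wpM2r e0 E3; rewrite mul1r -mulrA; lra.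
Qed.

Lemma even_locally_minimizing n : (0 < n)%N -> ~~ odd n ->
  locally_length_minimizing (frame n) 0 1 (@gamma R).
Proof.
move=> n0 ne; exists (n.+1%:R^-1); first by rewrite invr_gt0.
move=> s t _ st _ tsn; exists (fun=> vec2 0 1); first exact: horizontal_gamma.
move=> c d h v cd hv hc hd.
rewrite (length_cst _ (ltW st)) enorm_vec2_01 mul1r.
apply: (even_length_ge ne st _ cd hv hc hd).
by rewrite -ltr_pdivlMr// mul1r.
Qed.

End EvenExponent.

(** * Odd exponent: a shorter competitor *)

Section OddExponent.
Context {R : realType}.
Notation mu := (@lebesgue_measure R).

Lemma Rintegral_odd (a : R) (f : R -> R) : continuous f ->
  (forall t, f (- t) = - f t) -> \int[mu]_(t in `[- a, a]) f t = 0.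
Proof.
move=> cf fodd; have [a0|a0] := ltP a 0.
  rewrite set_itv_ge ?Rintegral_set0//.
  by rewrite bnd_simp -ltNge; lra.
have fi := continuous_integrable (- a) a cf.
have : \int[mu]_(t in `[- a, a]) f t = \int[mu]_(t in `[- a, a]) (f (- t)).
  rewrite /Rintegral -[X in `[_, X]](opprK a).
  rewrite -[LHS]/(fine _) integration_by_substitution_oppr ?opprK//; first lra.
  exact: continuous_subspaceT.
have -> : \int[mu]_(t in `[- a, a]) (f (- t)) =
    -1 * \int[mu]_(t in `[- a, a]) f t.
  by rewrite -RintegralZl//; apply: eq_Rintegral => t _; rewrite fodd mulN1r.
lra.
Qed.

(** The profile of the competitor in the x1-direction.  It is odd, so that its
    odd powers have integral 0, vanishes at both ends of [-1, 1], and takes two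
    different nonzero values. *)
Definition lobes (t : R) : R := t - t ^+ 3.

Lemma continuous_lobes : continuous lobes.
Proof. by move=> t; apply: cvgB; [exact: cvg_id|exact: exprn_continuous]. Qed.

Lemma continuous_lobesX m : continuous (fun t => lobes t ^+ m).
Proof.
move=> t; apply: (@continuous_comp _ _ _ lobes (fun y => y ^+ m)).
  exact: continuous_lobes.
exact: exprn_continuous.
Qed.

Lemma lobesN t : lobes (- t) = - lobes t.
Proof. rewrite /lobes; ring. Qed.

(** Let Q be lobes minus its projection on lobes^n, for the scalar product of
    L2.  A small multiple of Q subtracted from the constant 1 leaves
    the integral against lobes^n equal to 0, by oddness and orthogonality, and
    makes the integral against lobes equal to minus that multiple of the square
    norm of Q.  Since lobes takes two different positive values, it is not
    proportional to its n-th power, and Q is not 0. *)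
Lemma odd_weight n : odd n -> (1 < n)%N -> exists w : R -> R,
  [/\ continuous w, forall t, t \in `[-1, 1] -> 1 / 2 <= w t,
      \int[mu]_(t in `[-1, 1]) (w t * lobes t ^+ n) = 0 &
      \int[mu]_(t in `[-1, 1]) (w t * lobes t) < 0].
Proof.
move=> on n1.
have cP := continuous_lobesX.
have iP m : mu.-integrable `[-1, 1] (EFin \o (fun t => lobes t ^+ m)).
  exact: continuous_integrable.
have N1 : -1 < 1 :> R by lra.
have P0 : 0 < lobes (1 / 2) by rewrite /lobes; lra.
pose I m := \int[mu]_(t in `[-1, 1]) (lobes t ^+ m).
have Iodd m : odd m -> I m = 0.
  move=> om; apply: Rintegral_odd => [|t]; first exact: cP.
  by rewrite lobesN exprNn -signr_odd om expr1 mulN1r.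
have I2n : 0 < I (n + n)%N.
  apply: (@Rintegral_gt0 _ _ _ (1 / 2)) => //.
  - exact: continuous_subspaceT.
  - by move=> t _; rewrite exprn_even_ge0// oddD addbb.
  - by apply/andP; split; lra.
  - by rewrite exprn_gt0.
pose c := I n.+1 / I (n + n)%N.
pose Q t := lobes t - c * lobes t ^+ n.
have cQ : continuous Q.
  move=> t; apply: cvgB; first exact: continuous_lobes.
  by apply: cvgMl_tmp; exact: cP.
have iQ := continuous_integrable (-1) 1 cQ.
have cQP m : continuous (fun t => Q t * lobes t ^+ m).
  by move=> t; apply: cvgM; [exact: cQ|exact: cP].
have iQP m : mu.-integrable `[-1, 1] (EFin \o (fun t => Q t * lobes t ^+ m)).
  exact: continuous_integrable.
have QPn : \int[mu]_(t in `[-1, 1]) (Q t * lobes t ^+ n) = 0.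
  have -> : \int[mu]_(t in `[-1, 1]) (Q t * lobes t ^+ n) =
      \int[mu]_(t in `[-1, 1]) (lobes t ^+ n.+1 - c * lobes t ^+ (n + n)).
    by apply: eq_Rintegral => t _; rewrite /Q mulrBl -exprS -mulrA -exprD.
  rewrite RintegralB//; last exact: (integrableZl _ _ (iP _)).
  by rewrite RintegralZl// -/(I _) -/(I _) /c divfK ?subrr// gt_eqF.
have QQ : 0 < \int[mu]_(t in `[-1, 1]) (Q t ^+ 2).
  have cQ2 : continuous (fun t => Q t ^+ 2).
    move=> t; apply: (@continuous_comp _ _ _ Q (fun y => y ^+ 2)).
      exact: cQ.
    exact: exprn_continuous.
  (* Q vanishing at 1/2 and 1/4 would give lobes the same value at both. *)
  have [r rI Qr] : exists2 r, -1 <= r <= 1 & Q r != 0.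
    have [Qh|Qh] := eqVneq (Q (1 / 2)) 0; last by exists (1 / 2) => //; lra.
    exists (1 / 4); first lra.
    apply/eqP => Qq; have P1 : 0 < lobes (1 / 4) by rewrite /lobes; lra.
    have E r : 0 < lobes r -> Q r = 0 -> c * lobes r ^+ n.-1 = 1.
      move=> r0; rewrite /Q -[in X in _ * X](prednK (ltnW n1)) exprS mulrCA.
      rewrite -[X in X - _]mulr1 -mulrBr => /eqP; rewrite mulf_eq0 (gt_eqF r0)/=.
      by rewrite subr_eq0 => /eqP.
    have c0 : c != 0.
      by apply/eqP => c0; have := E _ P0 Qh; rewrite c0 mul0r; lra.
    have : lobes (1 / 2) ^+ n.-1 = lobes (1 / 4) ^+ n.-1.
      by apply: (mulfI c0); rewrite !E.
    move/eqP; rewrite eqrXn2 ?ltW//; last by rewrite -ltnS prednK// ltnW.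
    by move/eqP; rewrite /lobes; lra.
  apply: (@Rintegral_gt0 _ _ _ r) => //; first exact: continuous_subspaceT.
    by move=> t _; exact: sqr_ge0.
  by rewrite exprn_even_gt0.
have [M QM] : exists M : R, forall t, -1 <= t <= 1 -> `|Q t| <= M.
  by apply: within_bounded; exact: continuous_subspaceT.
have M0 : 0 <= M by apply: le_trans (QM 0 _) => //; lra.
(* Small enough to keep the weight above 1/2. *)
pose e := (2 * (M + 1))^-1.
have e0 : 0 < e by rewrite invr_gt0 mulr_gt0// ltr_wpDl.
have eM : e * M <= 1 / 2.
  by rewrite /e invfM -mulrA div1r ler_piMr// ler_pdivrMl; lra.
have QP : \int[mu]_(t in `[-1, 1]) (Q t * lobes t) =
    \int[mu]_(t in `[-1, 1]) (Q t ^+ 2).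
  have -> : \int[mu]_(t in `[-1, 1]) (Q t * lobes t) =
      \int[mu]_(t in `[-1, 1]) (Q t ^+ 2 + c * (Q t * lobes t ^+ n)).
    by apply: eq_Rintegral => t _; rewrite expr2 mulrCA -mulrDr /Q subrK.
  rewrite RintegralD//.
  - by rewrite RintegralZl// QPn mulr0 addr0.
  - apply: continuous_integrable => t.
    by under eq_fun do rewrite expr2; apply: cvgM; exact: cQ.
  - exact: (integrableZl _ _ (iQP _)).
exists (fun t => 1 - e * Q t); split.
- move=> t; apply: cvgB; first exact: cvg_cst.
  by apply: cvgMl_tmp; exact: cQ.
- move=> t; rewrite in_itv/= => tI.
  have := QM t tI; rewrite ler_norml => /andP[_ QtM].
  have : e * Q t <= e * M by rewrite ler_pM2l.
  lra.
- have -> : \int[mu]_(t in `[-1, 1]) ((1 - e * Q t) * lobes t ^+ n) =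
      \int[mu]_(t in `[-1, 1]) (lobes t ^+ n - e * (Q t * lobes t ^+ n)).
    by apply: eq_Rintegral => t _; rewrite mulrBl mul1r mulrA.
  rewrite RintegralB//; last exact: (integrableZl _ _ (iQP _)).
  by rewrite RintegralZl// QPn mulr0 subr0 -/(I n) Iodd.
- have -> : \int[mu]_(t in `[-1, 1]) ((1 - e * Q t) * lobes t) =
      \int[mu]_(t in `[-1, 1]) (lobes t ^+ 1 - e * (Q t * lobes t ^+ 1)).
    by apply: eq_Rintegral => t _; rewrite expr1 mulrBl mul1r mulrA.
  rewrite RintegralB//; last exact: (integrableZl _ _ (iQP _)).
  rewrite RintegralZl// -/(I 1%N) Iodd// sub0r oppr_lt0 mulr_gt0//.
  by under eq_Rintegral do rewrite expr1; rewrite QP.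
Qed.

End OddExponent.

Section OddCompetitor.
Context {R : realType}.
Notation mu := (@lebesgue_measure R).

(** Side displacement d lobes and forward speed S w.  The gain over a straight
    run is S d k, where - k is the integral of w lobes; the side motion adds at
    most 8 d^2 / S to the length, from the square root of
    (S w)^2 + (d lobes')^2 with w >= 1/2 and |lobes'| <= 2.  So a small d wins. *)
Lemma odd_shorter_curve n (s t : R) : odd n -> (1 < n)%N -> s < t ->
  exists h v, [/\ horizontal (frame n) (-1) 1 h v, h (-1) = gamma s,
    h 1 = gamma t & (control_length (-1) 1 v < (t - s)%:E)%E].
Proof.
move=> on n1 st.
have [w [cw w12 wPn]] := @odd_weight R n on n1.
have N1 : -1 <= 1 :> R by lra.
pose W := \int[mu]_(r in `[-1, 1]) (w r).
set k' := \int[mu]_(_ in _) _ => k'0; pose k := - k'.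
have k0 : 0 < k by rewrite oppr_gt0.
have iw := continuous_integrable (-1) 1 cw.
have W0 : 0 < W.
  apply: (Rintegral_gt0 (c := 0)) => [||r rI||].
  - lra.
  - exact: continuous_subspaceT.
  - by have := w12 r; rewrite in_itv/= => /(_ rI); lra.
  - by apply/andP; split; lra.
  - have := w12 0; rewrite in_itv/= => h; have {}h : 1 / 2 <= w 0.
      by apply: h; apply/andP; split; lra.
    lra.
pose T := t - s; have T0 : 0 < T by rewrite subr_gt0.
(* S0 bounds S from below, which lets d be chosen before S. *)
pose S0 := T / (W + k); have S00 : 0 < S0 by rewrite divr_gt0// addr_gt0.
(* The competitor wins as soon as 8 d < S^2 k. *)
pose d := Num.min 1 (S0 ^+ 2 * k / 16).
have d0 : 0 < d by rewrite lt_min ltr01 divr_gt0// mulr_gt0// exprn_gt0.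
have d1 : d <= 1 by rewrite ge_min lexx.
have dS : d <= S0 ^+ 2 * k / 16 by rewrite ge_min lexx orbT.
(* The speed for which the curve advances by exactly T. *)
pose S := T / (W + d * k).
have Wd0 : 0 < W + d * k by rewrite addr_gt0// mulr_gt0.
have S_gt0 : 0 < S by rewrite divr_gt0.
have S0S : S0 <= S.
  rewrite /S0 /S ler_pM2l// lef_pV2 ?posrE//; last exact: addr_gt0.
  by rewrite lerD2l ler_piMl// ltW.
have TE : T = S * W + S * (d * k) by rewrite -mulrDr /S divfK// gt_eqF.
pose q : 'rV[R]_3 := gamma s.
pose v r := vec2 (d * (1 - 3 * r ^+ 2)) (S * w r).
have cP' : continuous (fun r : R => 1 - 3 * r ^+ 2).
  move=> r; apply: cvgB; first exact: cvg_cst.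
  by apply: cvgMl_tmp; exact: exprn_continuous.
have iP' := continuous_integrable (-1) 1 cP'.
have iv : integrable_control (-1) 1 v.
  move=> j; elim/ord2P: j.
  - apply: (@eq_integrable _ _ _ mu _ (measurable_itv _)
      (EFin \o (fun r => d * (1 - 3 * r ^+ 2)))).
      by move=> r _ /=; rewrite vec2E.
    exact: (integrableZl _ _ iP').
  - apply: (@eq_integrable _ _ _ mu _ (measurable_itv _)
      (EFin \o (fun r => S * w r))).
      by move=> r _ /=; rewrite vec2E.
    exact: (integrableZl _ _ iw).
have xE r : -1 <= r <= 1 ->
    q 0 0 + \int[mu]_(p in `[-1, r]) (v p 0 0) = d * lobes r.
  move=> rI; rewrite /q mxE/= add0r.
  have -> : \int[mu]_(p in `[-1, r]) (v p 0 0) =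
      \int[mu]_(p in `[-1, r]) (d * (1 - 3 * p ^+ 2)).
    by apply: eq_Rintegral => p _; rewrite vec2E.
  rewrite RintegralZl//; last by apply: integrable_sub iP' => //; case/andP: rI.
  rewrite -(@ac_FTC _ (-1) 1 r _ lobes)//.
  - congr (_ * _); rewrite /lobes; ring.
  - by apply: acB; [exact: ac_id|apply: ac_exp; exact: ac_id].
  - apply: aeW => p _; rewrite /lobes.
    have := is_deriveX 3 (is_derive_id p (1 : R)); rewrite exprfctE => h.
    have := is_deriveB (is_derive_id p (1 : R)) h.
    by move=> /is_derive_eq; apply; rewrite /= /GRing.scale/=; ring.
exists (hcurve n (-1) q v), v; split.
- exact: horizontal_hcurve.
- exact: hcurve_start.
- rewrite /hcurve xE ?lexx ?N1//.
  have iwP m : mu.-integrable `[-1, 1] (EFin \o (fun r => w r * lobes r ^+ m)).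
    apply: continuous_integrable => r.
    by apply: cvgM; [exact: cw|exact: continuous_lobesX].
  have -> : \int[mu]_(r in `[-1, 1])
        (v r 0 1 * (1 - (q 0 0 + \int[mu]_(p in `[-1, r]) (v p 0 0)))) =
      \int[mu]_(r in `[-1, 1]) (S * (w r - d * (w r * lobes r ^+ 1))).
    apply: eq_Rintegral => r; rewrite inE/= in_itv/= => rI.
    by rewrite xE// vec2E expr1; ring.
  have iwP1 : mu.-integrable `[-1, 1] (EFin \o (fun r => d * (w r * lobes r ^+ 1))).
    exact: (integrableZl _ _ (iwP _)).
  rewrite RintegralZl//; last exact: (integrableB _ iw iwP1).
  rewrite RintegralB// RintegralZl//.
  have -> : \int[mu]_(r in `[-1, 1]) (w r * lobes r ^+ 1) = k'.
    by apply: eq_Rintegral => r _; rewrite expr1.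
  rewrite -/W.
  have -> : \int[mu]_(r in `[-1, 1])
        (v r 0 1 * (q 0 0 + \int[mu]_(p in `[-1, r]) (v p 0 0)) ^+ n) =
      \int[mu]_(r in `[-1, 1]) (S * d ^+ n * (w r * lobes r ^+ n)).
    apply: eq_Rintegral => r; rewrite inE/= in_itv/= => rI.
    by rewrite xE// vec2E exprMn; ring.
  rewrite RintegralZl// wPn mulr0 addr0 /q !mxE/=.
  have -> : d * lobes 1 = 0 by rewrite /lobes; ring.
  have -> : s + S * (W - d * k') = t.
    by have : t - s = T by []; rewrite TE /k; lra.
  by [].
- rewrite control_lengthE// lte_fin.
  have iSw : mu.-integrable `[-1, 1] (EFin \o (fun r => S * w r)).
    exact: (integrableZl _ _ iw).
  have ic : mu.-integrable `[-1, 1] (EFin \o (fun r : R => 4 * d ^+ 2 / S)).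
    exact: integrable_itv_cst.
  apply: (@le_lt_trans _ _ (\int[mu]_(r in `[-1, 1]) (S * w r + 4 * d ^+ 2 / S))).
    apply: le_Rintegral => //.
    - exact: integrable_enorm.
    - exact: (integrableD _ iSw ic).
    - move=> r rI; have w2 := w12 r rI; move: rI; rewrite /= in_itv/= => rI.
      have c0 : 0 <= 4 * d ^+ 2 / S.
        apply: divr_ge0; last exact: ltW.
        by apply: mulr_ge0; [lra|exact: sqr_ge0].
      have Sw0 : 0 <= S * w r by apply: mulr_ge0; [exact: ltW|lra].
      apply: le_enorm; first exact: addr_ge0.
      rewrite /v !vec2E.
      have -> : (S * w r + 4 * d ^+ 2 / S) ^+ 2 =
         (4 * d ^+ 2 / S) ^+ 2 + d ^+ 2 * (8 * w r) + (S * w r) ^+ 2.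
        by field; rewrite gt_eqF.
      rewrite lerD2r exprMn.
      have : d ^+ 2 * (1 - 3 * r ^+ 2) ^+ 2 <= d ^+ 2 * (8 * w r).
        rewrite ler_wpM2l ?sqr_ge0//.
        have r2 : r ^+ 2 <= 1.
          case/andP: rI => ? ?; rewrite -subr_ge0.
          have -> : 1 - r ^+ 2 = (1 - r) * (1 + r) by ring.
          by apply: mulr_ge0; lra.
        have r20 : 0 <= r ^+ 2 by exact: sqr_ge0.
        by nra.
      by have := sqr_ge0 (4 * d ^+ 2 / S); lra.
  rewrite RintegralD// RintegralZl// -/W Rintegral_itv_cst// -/T TE ltrD2l.
  have -> : 4 * d ^+ 2 / S * (1 - -1) = d / S * (8 * d) by field; rewrite gt_eqF.
  have -> : S * (d * k) = d / S * (S ^+ 2 * k) by field; rewrite gt_eqF.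
  rewrite ltr_pM2l ?divr_gt0//.
  have : S0 ^+ 2 * k <= S ^+ 2 * k by rewrite ler_pM2r// lerXn2r// nnegrE ltW.
  have : 0 < S0 ^+ 2 * k by rewrite mulr_gt0// exprn_gt0.
  by move: dS; lra.
Qed.

(** The derivative of gamma determines any control of gamma almost everywhere. *)
Lemma gamma_length n (s t : R) u : (0 < n)%N -> s <= t ->
  horizontal (frame n) s t (@gamma R) u -> control_length s t u = (t - s)%:E.
Proof.
move=> n0 st [acg mg dg].
have -> : (t - s)%:E = control_length s t (fun=> vec2 0 1) :> \bar R.
  by rewrite length_cst// enorm_vec2_01 mul1r.
apply: ae_eq_integral => //.
  by apply/measurable_EFinP; exact: measurable_enorm.
have [_ _ dg'] := @horizontal_gamma R n s t n0.
apply: (ae_imply2 _ dg dg') => r dr dr' rst.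
have {}rst : s <= r <= t by move: rst; rewrite /= in_itv.
have [_ e1] := dr rst; have [_ e2] := dr' rst.
congr (_%:E); congr enorm; move: e2; rewrite e1 !frame_vec3 !vec2E => e.
apply/rowP => j; elim/ord2P: j.
- by have := congr1 (fun p : 'rV[R]_3 => p 0 0) e; rewrite !vec3E vec2E.
- have := congr1 (fun p : 'rV[R]_3 => p 0 1) e.
  by rewrite !vec3E ?vec2E ?mxE/= subr0 !mulr1.
Qed.

Lemma odd_not_minimizing n (s t : R) : odd n -> (1 < n)%N -> s < t ->
  ~ length_minimizing (frame n) s t (@gamma R).
Proof.
move=> on n1 st [u hu umin].
have [h [v [hv h0 h1 vlt]]] := odd_shorter_curve on n1 st.
have := umin (-1) 1 h v ltac:(lra) hv h0 h1.
by rewrite (gamma_length (ltnW n1) (ltW st) hu) leNgt vlt.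
Qed.

Lemma odd_not_locally_minimizing n : odd n -> (1 < n)%N ->
  ~ locally_length_minimizing (frame n) 0 1 (@gamma R).
Proof.
move=> on n1 [d d0 dmin].
pose t := Num.min 1 (d / 2).
have t0 : 0 < t by rewrite lt_min ltr01 divr_gt0.
apply: (odd_not_minimizing on n1 t0); apply: dmin => //.
  by rewrite ge_min lexx.
by rewrite subr0 gt_min; apply/orP; right; lra.
Qed.

End OddCompetitor.

(** * Controls in L2 and differentials *)

Section SquareIntegrable.
Context {R : realType}.
Notation mu := (@lebesgue_measure R).
Implicit Types u v w : R -> 'rV[R]_2.

Lemma L2_integrable_control u : L2_control u -> integrable_control 0 1 u.
Proof.
move=> [mu_ iu] j.
have i1 : mu.-integrable `[0, 1] (EFin \o (fun=> 1 : R)).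
  exact: integrable_itv_cst.
have i2 : mu.-integrable `[0, 1] (EFin \o (fun t => 1 + enorm (u t) ^+ 2)).
  exact: (integrableD _ i1 iu).
move: i2; apply: le_integrable => //; first by apply/measurable_EFinP; exact: mu_.
move=> t _ /=; rewrite lee_fin [leRHS]ger0_norm ?addr_ge0 ?sqr_ge0//.
rewrite (le_trans (enorm_ge_coord _ _))//.
by have := sqr_ge0 (enorm (u t) - 1); have := enorm_ge0 (u t); nra.
Qed.

Lemma L2_norm_ge0 u : 0 <= L2_norm u. Proof. exact: sqrtr_ge0. Qed.

Lemma L2_norm_sqr u :
  L2_norm u ^+ 2 = \int[mu]_(t in `[0, 1]) (enorm (u t) ^+ 2).
Proof.
by rewrite sqr_sqrtr//; apply: Rintegral_ge0 => t _; exact: sqr_ge0.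
Qed.

(** Expand the integral of (|u| - m)^2, where m is the integral of |u|. *)
Lemma L1_le_L2 u : L2_control u ->
  \int[mu]_(t in `[0, 1]) enorm (u t) <= L2_norm u.
Proof.
move=> Lu; have ie := integrable_enorm (L2_integrable_control Lu).
have [_ i2] := Lu; set m := \int[mu]_(t in _) _.
have m0 : 0 <= m by apply: Rintegral_ge0 => t _; exact: enorm_ge0.
rewrite -(ler_sqr m0 (L2_norm_ge0 u)) L2_norm_sqr.
have : 0 <= \int[mu]_(t in `[0, 1]) ((enorm (u t) - m) ^+ 2).
  by apply: Rintegral_ge0 => t _; exact: sqr_ge0.
have -> : \int[mu]_(t in `[0, 1]) ((enorm (u t) - m) ^+ 2) =
    \int[mu]_(t in `[0, 1]) ((enorm (u t) ^+ 2 - (2 * m) * enorm (u t)) + m ^+ 2).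
  by apply: eq_Rintegral => t _; ring.
have ime : mu.-integrable `[0, 1] (EFin \o (fun t => (2 * m) * enorm (u t))).
  exact: (integrableZl _ _ ie).
have ic : mu.-integrable `[0, 1] (EFin \o (fun=> m ^+ 2)).
  exact: integrable_itv_cst.
have id : mu.-integrable `[0, 1]
    (EFin \o (fun t => enorm (u t) ^+ 2 - (2 * m) * enorm (u t))).
  exact: (integrableB _ i2 ime).
rewrite RintegralD// RintegralB// RintegralZl// Rintegral_itv_cst// -/m.
lra.
Qed.

Lemma L2Z (c : R) v : L2_control v -> L2_control (c *: v).
Proof.
move=> [mv iv]; split.
  move=> j; rewrite (_ : (fun t => _) = (fun t => c * v t 0 j)).
    by apply: measurable_funM => //; exact: mv.
  by apply/funext => t; rewrite mxE.
have : mu.-integrable `[0, 1] (EFin \o (fun t => c ^+ 2 * enorm (v t) ^+ 2)).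
  exact: (integrableZl _ _ iv).
apply: eq_integrable => // t _ /=; congr (_%:E).
by rewrite !enorm_sqr !mxE; ring.
Qed.

Lemma L2_linear (c : R) v w : L2_control v -> L2_control w ->
  L2_control (c *: v + w).
Proof.
move=> Lv Lw; have /L2_integrable_control icv := L2Z c Lv.
have iw := L2_integrable_control Lw.
have iv := L2_integrable_control Lv.
have mvw : measurable_control 0 1 (c *: v + w).
  by apply: integrable_control_measurable; exact: integrable_controlD.
split => //.
have [_ iv2] := Lv; have [_ iw2] := Lw.
have i1 : mu.-integrable `[0, 1] (EFin \o (fun t => (2 * c ^+ 2) * enorm (v t) ^+ 2)).
  exact: (integrableZl _ _ iv2).
have i2 : mu.-integrable `[0, 1] (EFin \o (fun t => 2 * enorm (w t) ^+ 2)).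
  exact: (integrableZl _ _ iw2).
have i3 : mu.-integrable `[0, 1] (EFin \o
    (fun t => (2 * c ^+ 2) * enorm (v t) ^+ 2 + 2 * enorm (w t) ^+ 2)).
  exact: (integrableD _ i1 i2).
move: i3; apply: le_integrable => //.
  apply/measurable_EFinP; apply: measurable_funX.
  exact: measurable_enorm.
move=> t _ /=; rewrite lee_fin ger0_norm ?sqr_ge0//.
rewrite (le_trans _ (ler_norm _))// !enorm_sqr !mxE.
have := sqr_ge0 (c * v t 0 0 - w t 0 0).
have := sqr_ge0 (c * v t 0 1 - w t 0 1).
by nra.
Qed.

Lemma L2_normZ (c : R) v : 0 <= c -> L2_control v ->
  L2_norm (c *: v) = c * L2_norm v.
Proof.
move=> c0 [mv iv]; apply/eqP.
rewrite -(@eqrXn2 _ 2) ?L2_norm_ge0 ?mulr_ge0 ?L2_norm_ge0// exprMn !L2_norm_sqr.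
rewrite -RintegralZl//; apply/eqP/eq_Rintegral => t _.
by rewrite !enorm_sqr !mxE; ring.
Qed.

Lemma bounded_L2 u (M : R) : measurable_control 0 1 u ->
  (forall t, 0 <= t <= 1 -> enorm (u t) <= M) -> L2_control u.
Proof.
move=> mu_ uM; split => //.
have ic : mu.-integrable `[0, 1] (EFin \o (fun=> M ^+ 2)).
  exact: integrable_itv_cst.
move: ic; apply: le_integrable => //.
  apply/measurable_EFinP; apply: measurable_funX.
  exact: measurable_enorm.
move=> t; rewrite /= in_itv/= => /uM utM; rewrite lee_fin !normrX.
by rewrite lerXn2r ?nnegrE// (ger0_norm (enorm_ge0 _)) (le_trans utM)// ler_norm.
Qed.

Lemma L2_cst (c : 'rV[R]_2) : L2_control (fun=> c).
Proof.
by apply: (@bounded_L2 _ (enorm c)) => // j; exact: measurable_cst.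
Qed.

Lemma continuous_L2 (f g : R -> R) : {within `[0, 1], continuous f} ->
  {within `[0, 1], continuous g} -> L2_control (fun t => vec2 (f t) (g t)).
Proof.
move=> cf cg; have [F fF] := within_bounded cf; have [G gG] := within_bounded cg.
apply: (@bounded_L2 _ (F + G)).
  move=> j; elim/ord2P: j.
  - rewrite (_ : (fun t => _) = f); first exact: within_measurable.
    by apply/funext => t; rewrite vec2E.
  - rewrite (_ : (fun t => _) = g); first exact: within_measurable.
    by apply/funext => t; rewrite vec2E.
move=> t tI; rewrite (le_trans (enorm_le_sum _))// !vec2E.
by rewrite lerD ?fF ?gG.
Qed.

(** Used for the coordinate projections of the target of the extended end-point
    map. *)
Lemma L2_differential_comp (V W : normedModType R) (p : V -> W)
  (G : (R -> 'rV[R]_2) -> V) u dG :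
  (forall c x y, p (c *: x + y) = c *: p x + p y) ->
  (forall x, `|p x| <= `|x|) ->
  is_L2_differential G u dG -> is_L2_differential (p \o G) u (p \o dG).
Proof.
move=> plin pn [dlin [C dC] dd]; split.
- by move=> c v w Lv Lw /=; rewrite dlin.
- by exists C => v Lv; rewrite (le_trans (pn _))//; exact: dC.
- move=> e /dd[d d0 dH]; exists d => // v Lv vd.
  have pB x y : p (x - y) = p x - p y.
    by rewrite addrC -scaleN1r plin scaleN1r addrC.
  by rewrite /= -!pB (le_trans (pn _))//; exact: dH.
Qed.

(** A differential is determined by the behaviour along rays; all the rays
    that are used give polynomials of degree at most 2. *)
Lemma L2_differential_dir (G : (R -> 'rV[R]_2) -> R^o) u dG v (w z : R) :
  is_L2_differential G u dG -> L2_control v ->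
  (forall e : R, 0 < e -> G (u + e *: v) = G u + e * w + e ^+ 2 * z) ->
  dG v = w.
Proof.
move=> [dlin _ dd] Lv Gv.
have L0 : L2_control (0 : R -> 'rV[R]_2).
  have -> : (0 : R -> 'rV[R]_2) = 0 *: v by rewrite scale0r.
  exact: L2Z.
have dG0 : dG 0 = 0.
  have := dlin 1 0 0 L0 L0; rewrite scale1r scale1r addr0 => /esym/eqP.
  by rewrite -subr_eq0 addrK => /eqP.
have dGZ c : dG (c *: v) = c * dG v.
  by have := dlin c v 0 Lv L0; rewrite !addr0 dG0 addr0.
have N0 := L2_norm_ge0 v; set N := L2_norm v in N0.
apply/eqP; rewrite eq_sym -subr_eq0 -normr_le0; apply/ler_addgt0Pl => a a0.
rewrite addr0.
have N1 : 0 < N + 1 by rewrite ltr_wpDl.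
have [d d0 dH] := dd (a / 2 / (N + 1)) ltac:(by rewrite !divr_gt0).
(* Small enough for the differential estimate and for the quadratic term. *)
pose e := Num.min (d / 2 / (N + 1)) (a / 2 / (`|z| + 1)).
have z1 : 0 < `|z| + 1 by rewrite ltr_wpDl.
have e0 : 0 < e by rewrite lt_min !divr_gt0.
have eN : e * (N + 1) <= d / 2 by rewrite -ler_pdivlMr// ge_min lexx.
have ez : e * (`|z| + 1) <= a / 2 by rewrite -ler_pdivlMr// ge_min lexx orbT.
have := dH (e *: v) (L2Z e Lv); rewrite (L2_normZ (ltW e0) Lv) -/N => /(_ ltac:(lra)).
rewrite Gv// dGZ.
have -> : G u + e * w + e ^+ 2 * z - G u - e * dG v = e * (w - dG v + e * z).
  by ring.
rewrite normrM gtr0_norm// mulrCA ler_pM2l// => h.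
have : a / 2 / (N + 1) * N <= a / 2.
  rewrite mulrAC ler_pdivrMr// ler_pM2l ?divr_gt0//; lra.
have : `|w - dG v| <= `|w - dG v + e * z| + `|e * z|.
  by rewrite -{1}(addrK (e * z) (w - dG v)) ler_normB.
rewrite (normrM e) (gtr0_norm e0).
move: h ez; set X := `|_ + _|; set Y := `|w - _|; have := normr_ge0 z.
move: e0; nra.
Qed.

End SquareIntegrable.

(** * The curve gamma is strictly singular *)

Section GammaSingular.
Context {R : realType}.
Notation mu := (@lebesgue_measure R).
Implicit Types v w : R -> 'rV[R]_2.

(** The x1-component of the curve from the origin with control v.  To first order
    at gamma, it enters the x2-coordinate of the end-point through its integral
    [lateral_area]. *)
Definition lateral v t := \int[mu]_(s in `[0, t]) (v s 0 0).
Definition forward v := \int[mu]_(s in `[0, 1]) (v s 0 1).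
Definition lateral_area v := \int[mu]_(s in `[0, 1]) lateral v s.

(** The differential at gamma of the extended end-point map.  The vanishing
    x3-component is where n >= 2 enters. *)
Definition dgamma v : 'rV[R]_3 * R^o :=
  (vec3 (lateral v 1) (forward v - lateral_area v) 0, forward v).

Lemma le_forward v : L2_control v ->
  \int[mu]_(s in `[0, 1]) `|v s 0 1| <= L2_norm v.
Proof.
move=> Lv; have iv := L2_integrable_control Lv.
rewrite (le_trans _ (L1_le_L2 Lv))//; apply: le_Rintegral => //.
- exact/integrable_norm/iv.
- exact: integrable_enorm.
- by move=> t _; exact: enorm_ge_coord.
Qed.

Lemma le_lateral v t : L2_control v -> 0 <= t <= 1 ->
  `|lateral v t| <= L2_norm v.
Proof.
move=> Lv /andP[t0 t1]; have iv := L2_integrable_control Lv.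
have ie := integrable_enorm iv.
rewrite (le_trans _ (L1_le_L2 Lv))//.
rewrite (le_trans (le_normr_Rintegral _ _))//; first exact: integrable_sub (iv 0).
apply: (@le_trans _ _ (\int[mu]_(s in `[0, t]) enorm (v s))).
  apply: le_Rintegral => //.
  - exact/integrable_norm/(integrable_sub _ _ (iv 0)).
  - exact: integrable_sub ie.
  - by move=> s _; exact: enorm_ge_coord.
rewrite -subr_ge0 (Rintegral_itv_diff ie)//.
by apply: Rintegral_ge0 => s _; exact: enorm_ge0.
Qed.

Lemma continuous_lateral v : L2_control v ->
  {within `[0, 1], continuous (lateral v)}.
Proof. by move=> /L2_integrable_control iv; exact/continuous_Rintegral/iv. Qed.

Lemma lateral_lin c v w t : L2_control v -> L2_control w -> 0 <= t <= 1 ->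
  lateral (c *: v + w) t = c * lateral v t + lateral w t.
Proof.
move=> Lv Lw /andP[t0 t1].
have iv := le_integrable_control t1 (L2_integrable_control Lv).
have iw := le_integrable_control t1 (L2_integrable_control Lw).
rewrite /lateral -RintegralZl// -RintegralD//.
- by apply: eq_Rintegral => s _; rewrite !mxE.
- exact: (integrableZl _ _ (iv 0)).
Qed.

Lemma forward_lin c v w : L2_control v -> L2_control w ->
  forward (c *: v + w) = c * forward v + forward w.
Proof.
move=> Lv Lw.
have iv := L2_integrable_control Lv; have iw := L2_integrable_control Lw.
rewrite /forward -RintegralZl// -RintegralD//.
- by apply: eq_Rintegral => s _; rewrite !mxE.
- exact: (integrableZl _ _ (iv 1)).
Qed.

Lemma lateral_area_lin c v w : L2_control v -> L2_control w ->
  lateral_area (c *: v + w) = c * lateral_area v + lateral_area w.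
Proof.
move=> Lv Lw; have iv := within_integrable (continuous_lateral Lv).
have iw := within_integrable (continuous_lateral Lw).
rewrite /lateral_area -RintegralZl// -RintegralD//.
- by apply: eq_Rintegral => s; rewrite inE/= in_itv/= => sI; rewrite lateral_lin.
- exact: (integrableZl _ _ iv).
Qed.

Lemma norm_pair (p : 'rV[R]_3) (r : R) :
  `|(p, r) : 'rV[R]_3 * R^o| <= `|p| + `|r|.
Proof. by rewrite prod_normE /= ge_max lerDl lerDr !normr_ge0. Qed.

Lemma vec3_lin (c a1 a2 a3 b1 b2 b3 : R) :
  c *: vec3 a1 a2 a3 + vec3 b1 b2 b3 =
  vec3 (c * a1 + b1) (c * a2 + b2) (c * a3 + b3).
Proof. by apply/rowP; apply: ord3P; rewrite !mxE. Qed.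

Lemma dgamma_lin c v w : L2_control v -> L2_control w ->
  dgamma (c *: v + w) = c *: dgamma v + dgamma w.
Proof.
move=> Lv Lw; rewrite /dgamma lateral_lin ?ler01 ?lexx//.
rewrite forward_lin// lateral_area_lin//.
congr pair; rewrite /= vec3_lin; congr vec3; ring.
Qed.

Lemma norm_forward v : L2_control v -> `|forward v| <= L2_norm v.
Proof.
move=> Lv; rewrite (le_trans _ (le_forward Lv))//.
apply: le_normr_Rintegral => //; exact: (L2_integrable_control Lv).
Qed.

Lemma norm_lateral_area v : L2_control v -> `|lateral_area v| <= L2_norm v.
Proof.
move=> Lv; have iX := within_integrable (continuous_lateral Lv).
rewrite (le_trans (le_normr_Rintegral _ iX))//.
have -> : L2_norm v = \int[mu]_(s in `[0, 1]) (L2_norm v).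
  by rewrite Rintegral_itv_cst// subr0 mulr1.
apply: le_Rintegral => //.
- exact: integrable_norm.
- exact: integrable_itv_cst.
- by move=> t; rewrite /= in_itv/= => tI; exact: le_lateral.
Qed.

Lemma endpoint_gamma n v : L2_control v ->
  endpoint (frame n) (gamma 0) ((fun=> vec2 0 1) + v) =
  vec3 (lateral v 1)
    (1 + forward v - lateral_area v -
      \int[mu]_(s in `[0, 1]) (v s 0 1 * lateral v s))
    (\int[mu]_(s in `[0, 1]) ((1 + v s 0 1) * lateral v s ^+ n)).
Proof.
move=> Lv; have iv := L2_integrable_control Lv.
have i01 : integrable_control 0 1 (fun=> vec2 0 1 : 'rV[R]_2).
  exact/L2_integrable_control/L2_cst.
rewrite endpoint_hcurve; last exact: integrable_controlD.
have xE t : (gamma 0 : 'rV[R]_3) 0 0 +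
    \int[mu]_(s in `[0, t]) (((fun=> vec2 0 1) + v) s 0 0) = lateral v t.
  rewrite [X in X + _]mxE/= add0r; apply: eq_Rintegral => s _.
  by rewrite mxE vec2E add0r.
rewrite /hcurve xE; congr vec3.
- rewrite mxE/= add0r.
  have iX := within_integrable (continuous_lateral Lv).
  have ivX := integrable_mul_cont (iv 1) (continuous_lateral Lv).
  have i1 : mu.-integrable `[0, 1] (EFin \o (fun s => 1 + v s 0 1)).
    apply: (@eq_integrable _ _ _ mu _ (measurable_itv _)
      (EFin \o (fun s => ((fun=> vec2 0 1) + v) s 0 1))).
      by move=> s _ /=; rewrite mxE vec2E.
    exact: integrable_controlD.
  have i2 : mu.-integrable `[0, 1] (EFin \o (fun s => 1 + v s 0 1 - lateral v s)).
    exact: (integrableB _ i1 iX).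
  have ic : mu.-integrable `[0, 1] (EFin \o (fun=> 1 : R)).
    exact: integrable_itv_cst.
  have -> : 1 + forward v - lateral_area v =
      \int[mu]_(s in `[0, 1]) (1 + v s 0 1 - lateral v s).
    have iv1 := iv 1.
    rewrite (RintegralB _ i1 iX)// (RintegralD _ ic iv1)//.
    by rewrite Rintegral_itv_cst// subr0 mulr1.
  rewrite -RintegralB//; apply: eq_Rintegral => s _.
  by rewrite xE mxE vec2E; ring.
- rewrite mxE/= add0r; apply: eq_Rintegral => s _.
  by rewrite xE mxE vec2E.
Qed.

Lemma energy_gamma v : L2_control v ->
  2^-1 * L2_norm ((fun=> vec2 0 1) + v) ^+ 2 =
  2^-1 + forward v + 2^-1 * L2_norm v ^+ 2.
Proof.
move=> Lv; have iv := L2_integrable_control Lv; have [_ i2] := Lv.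
rewrite !L2_norm_sqr.
have ic : mu.-integrable `[0, 1] (EFin \o (fun=> 1 : R)).
  exact: integrable_itv_cst.
have i1 : mu.-integrable `[0, 1] (EFin \o (fun s => 2 * v s 0 1)).
  exact: (integrableZl _ _ (iv 1)).
have i3 : mu.-integrable `[0, 1] (EFin \o (fun s => 1 + 2 * v s 0 1)).
  exact: (integrableD _ ic i1).
have -> : \int[mu]_(t in `[0, 1]) (enorm (((fun=> vec2 0 1) + v) t) ^+ 2) =
    \int[mu]_(t in `[0, 1]) (1 + 2 * v t 0 1 + enorm (v t) ^+ 2).
  apply: eq_Rintegral => t _.
  by rewrite !enorm_sqr !mxE/=; ring.
have iv1 := iv 1.
rewrite (RintegralD _ i3 i2)// (RintegralD _ ic i1)// (RintegralZl _ _ iv1)//.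
by rewrite Rintegral_itv_cst// -/(forward v); lra.
Qed.

(** With N the norm of v, the remainder consists of the integral of
    v2 x1, at most N^2, of that of (1 + v2) x1^n, at most N^n (1 + N), and of
    N^2 / 2. *)
Lemma dgamma_differential n : (1 < n)%N ->
  is_L2_differential (extended_endpoint (frame n) (gamma 0))
    (fun=> vec2 0 1) dgamma.
Proof.
move=> n1; split; first exact: dgamma_lin.
  exists 4 => v Lv; rewrite (le_trans (norm_pair _ _))//.
  have := norm_vec3 (lateral v 1) (forward v - lateral_area v) 0.
  rewrite normr0 addr0.
  have := le_lateral Lv (_ : 0 <= 1 <= 1); rewrite ler01 lexx => /(_ isT).
  have := norm_forward Lv; have := norm_lateral_area Lv.
  have := ler_normB (forward v) (lateral_area v); lra.
have L0 : L2_control (0 : R -> 'rV[R]_2) by exact: (@L2_cst R 0).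
have X0 t : lateral 0 t = 0.
  rewrite /lateral (_ : \int[mu]_(s in _) _ = \int[mu]_(s in `[0, t]) (0 * 0)).
    by rewrite RintegralZl// ?mul0r//; exact: integrable_itv_cst.
  by apply: eq_Rintegral => s _; rewrite mxE mul0r.
have M0 : forward 0 = 0.
  have := forward_lin 1 L0 L0; rewrite scale1r addr0 mul1r => /esym/eqP.
  by rewrite -subr_eq0 addrK => /eqP.
have base : extended_endpoint (frame n) (gamma 0) (fun=> vec2 0 1 : 'rV[R]_2) =
    (vec3 0 1 0, 2^-1 : R^o).
  rewrite -[fun=> _]addr0 /extended_endpoint endpoint_gamma// energy_gamma//.
  have -> : L2_norm (0 : R -> 'rV[R]_2) = 0.
    by rewrite -(scale0r (0 : R -> 'rV[R]_2)) L2_normZ// mul0r.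
  have Bz : lateral_area 0 = 0.
    have := lateral_area_lin 1 L0 L0; rewrite scale1r addr0 mul1r => /esym/eqP.
    by rewrite -subr_eq0 addrK => /eqP.
  rewrite X0 M0 Bz expr0n/= mulr0 !addr0 subr0.
  rewrite [X in _ - X](_ : _ = forward 0) ?M0 ?subr0; last first.
    by rewrite -[RHS]M0; apply: eq_Rintegral => s _; rewrite X0 mulr0 mxE.
  congr (vec3 _ _ _, _); rewrite -[RHS]M0.
  apply: eq_Rintegral => s _.
  by rewrite X0 expr0n eqn0Ngt (ltnW n1)/= mulr0 mxE.
(* The remainder is at most N^2 + 2 N^2 + N^2 / 2 <= 4 N^2 when N < 1. *)
move=> e e0; exists (Num.min 1 (e / 4)); first by rewrite lt_min ltr01 divr_gt0.
move=> v Lv; rewrite lt_min => /andP[N1 Ne].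
have N0 := L2_norm_ge0 v; set N := L2_norm v in N1 Ne N0 *.
have iv := L2_integrable_control Lv; have cX := continuous_lateral Lv.
have ivX := integrable_mul_cont (iv 1) cX.
pose Y := \int[mu]_(s in `[0, 1]) (v s 0 1 * lateral v s).
pose Z := \int[mu]_(s in `[0, 1]) ((1 + v s 0 1) * lateral v s ^+ n).
have -> : extended_endpoint (frame n) (gamma 0) ((fun=> vec2 0 1) + v) -
    extended_endpoint (frame n) (gamma 0) (fun=> vec2 0 1) - dgamma v =
    (vec3 0 (- Y) Z, 2^-1 * N ^+ 2 : R^o).
  rewrite base /extended_endpoint endpoint_gamma// energy_gamma// /dgamma.
  congr pair; last by rewrite /= /N; ring.
  by rewrite /=; apply/rowP; apply: ord3P; rewrite !mxE/= -/Y -/Z; ring.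
rewrite (le_trans (norm_pair _ _))//.
have := norm_vec3 0 (- Y) Z; rewrite normr0 add0r normrN => Vle.
have Yle : `|Y| <= N * N.
  rewrite (le_trans (le_normr_Rintegral _ ivX))//.
  apply: (@le_trans _ _ (\int[mu]_(s in `[0, 1]) (N * `|v s 0 1|))).
    apply: le_Rintegral => //.
    - exact: integrable_norm.
    - exact: (integrableZl _ _ (integrable_norm (iv 1))).
    - move=> s; rewrite /= in_itv/= => sI.
      by rewrite normrM mulrC ler_wpM2r// le_lateral.
  have inv1 := integrable_norm (iv 1).
  by rewrite (RintegralZl _ _ inv1)// ler_wpM2l// le_forward.
have Zle : `|Z| <= 2 * (N * N).
  have ic : mu.-integrable `[0, 1] (EFin \o (fun=> 1 : R)).
    exact: integrable_itv_cst.
  have i1 : mu.-integrable `[0, 1] (EFin \o (fun s => 1 + v s 0 1)).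
    exact: (integrableD _ ic (iv 1)).
  have iZ := integrable_mul_cont i1 (@within_exp _ _ _ _ n cX).
  rewrite (le_trans (le_normr_Rintegral _ iZ))//.
  have i2 : mu.-integrable `[0, 1] (EFin \o (fun s => 1 + `|v s 0 1|)).
    exact: (integrableD _ ic (integrable_norm (iv 1))).
  apply: (@le_trans _ _ (\int[mu]_(s in `[0, 1]) ((N * N) * (1 + `|v s 0 1|)))).
    apply: le_Rintegral => //.
    - exact: integrable_norm.
    - exact: (integrableZl _ _ i2).
    - move=> s; rewrite /= in_itv/= => sI.
      rewrite normrM mulrC normrX; apply: ler_pM => //.
        rewrite -expr2 (@le_trans _ _ (N ^+ n))//.
          by rewrite lerXn2r ?nnegrE// le_lateral.
        by apply: ler_wiXn2l => //; exact: ltW.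
      by rewrite (le_trans (ler_normD _ _))// normr1.
  have inv1 := integrable_norm (iv 1).
  rewrite (RintegralZl _ _ i2)// (RintegralD _ ic inv1)//.
  rewrite Rintegral_itv_cst// subr0 mulr1 mulrC ler_wpM2r ?mulr_ge0//.
  by have := le_forward Lv; rewrite -/N; lra.
have NN : `|2^-1 * N ^+ 2| = 2^-1 * (N * N).
  by rewrite ger0_norm ?mulr_ge0 ?sqr_ge0// expr2.
have : N * N <= e / 4 * N by rewrite ler_wpM2r// ltW.
have NN0 : 0 <= N * N by rewrite mulr_ge0.
rewrite NN; lra.
Qed.

Lemma half_itv : 0 <= (1 / 2 : R) <= 1.
Proof. by apply/andP; split; lra. Qed.

Lemma half_bump : 0 < 1 / 2 - (1 / 2) ^+ 2 :> R.
Proof. lra. Qed.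

(** The x3-direction is not in the image of the differential.  Let the covector
    (l, l0) kill the image.  The control (1 - 2 t, 0) returns to x1 = 0
    after enclosing a positive area, which forces the second component of l to
    be 0; the control (0, 1) then forces l0 = 0. *)
Lemma gamma_strictly_singular n : (1 < n)%N ->
  strictly_singular (frame n) (@gamma R).
Proof.
move=> n1; exists (fun=> vec2 0 1); split.
- exact: L2_cst.
- exact/horizontal_gamma/ltnW.
exists dgamma; split; first exact: dgamma_differential.
  move=> /(_ (vec3 0 0 1, 0))[v _ [/(congr1 (fun p : 'rV[R]_3 => p 0 2))]].
  by rewrite !vec3E => /esym/eqP; rewrite oner_eq0.
move=> l l0 H.
have H1 := H _ (@L2_cst R (vec2 0 1)).
(* Its lateral displacement is t - t^2. *)
pose w t : 'rV[R]_2 := vec2 (1 - 2 * t) 0.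
have cf : continuous (fun t : R => 1 - 2 * t).
  move=> t; apply: cvgB; first exact: cvg_cst.
  by apply: cvgMl_tmp; exact: cvg_id.
have Lw : L2_control w.
  apply: (@continuous_L2 _ (fun t => 1 - 2 * t) (fun=> 0)).
    exact: continuous_subspaceT.
  by apply: continuous_subspaceT => ?; exact: cst_continuous.
have H2 := H _ Lw.
have cst_int (c : R) : \int[mu]_(s in `[0, 1]) c = c.
  by rewrite Rintegral_itv_cst// subr0 mulr1.
have X1 t : lateral (fun=> vec2 0 1) t = 0.
  rewrite /lateral (_ : \int[mu]_(s in _) _ = \int[mu]_(s in `[0, t]) (0 * 0)).
    by rewrite RintegralZl// ?mul0r//; exact: integrable_itv_cst.
  by apply: eq_Rintegral => s _; rewrite vec2E mul0r.
have M1 : forward (fun=> vec2 0 1) = 1.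
  by rewrite /forward -[RHS]cst_int; apply: eq_Rintegral => s _; rewrite vec2E.
have B1 : lateral_area (fun=> vec2 0 1) = 0.
  by rewrite /lateral_area -[RHS]cst_int; apply: eq_Rintegral => s _; rewrite X1.
have Xw t : 0 <= t <= 1 -> lateral w t = t - t ^+ 2.
  move=> tI; rewrite -[RHS]subr0 -[X in _ - X](_ : 0 - 0 ^+ 2 = 0); last first.
    by rewrite expr0n subr0.
  rewrite (@ac_FTC _ 0 1 t (fun t => 1 - 2 * t) (fun t => t - t ^+ 2))//.
  - by apply: eq_Rintegral => s _; rewrite vec2E.
  - by apply: acB; [exact: ac_id|apply: (@ac_exp _ _ _ id 1); exact: ac_id].
  - exact: continuous_integrable.
  - apply: aeW => p _.
    have := is_deriveX 2 (is_derive_id p (1 : R)); rewrite exprfctE => h.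
    have := is_deriveB (is_derive_id p (1 : R)) h.
    by move=> /is_derive_eq; apply; rewrite /= /GRing.scale/=; ring.
have Mw : forward w = 0.
  by rewrite /forward -[RHS]cst_int; apply: eq_Rintegral => s _; rewrite vec2E.
have Bw : 0 < lateral_area w.
  apply: (@Rintegral_gt0 _ 0 1 (1 / 2)) => //.
  - exact: continuous_lateral.
  - move=> t tI; rewrite Xw// expr2 -{1}(mulr1 t) -mulrBr.
    by case/andP: tI => ? ?; rewrite mulr_ge0// subr_ge0.
  - exact: half_itv.
  - rewrite Xw; last exact: half_itv.
    exact: half_bump.
have e2 : l 0 1 * (- lateral_area w) = 0.
  by rewrite -H2 sum3E /dgamma /= !vec3E Mw Xw ?lexx ?ler01// expr1n; ring.
have l1 : l 0 1 = 0.
  move/eqP: e2; rewrite mulrN oppr_eq0 mulf_eq0 (gt_eqF Bw) orbF.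
  by move/eqP.
have <- : l 0 1 + l0 = l0 by rewrite l1 add0r.
by rewrite -H1 sum3E /dgamma /= !vec3E X1 M1 B1; ring.
Qed.

End GammaSingular.

(** * Strictly singular curves through the origin *)

(** A matrix of maximal rank among those with rows in S has row space S; a
    column of its cokernel that does not kill w is the required covector. *)
Lemma subspace_annihilator (F : fieldType) m (S : set 'rV[F]_m) : S 0 ->
  (forall c x y, S x -> S y -> S (c *: x + y)) -> (exists w, ~ S w) ->
  exists2 l : 'cV[F]_m, l != 0 & forall x, S x -> x *m l = 0.
Proof.
move=> S0 Slin [w Sw].
pose P r := `[< exists k (A : 'M[F]_(k, m)),
  (forall i, S (row i A)) /\ \rank A = r >].
have exP : exists r, P r.
  exists 0%N; apply/asboolP; exists 0%N, 0; split; last by rewrite mxrank0.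
  by case.
have ubP r : P r -> (r <= m)%N.
  by move=> /asboolP[k [A [_ <-]]]; exact: rank_leq_col.
case: (ex_maxnP exP ubP) => r /asboolP[k [A [SA rA]]] rmax.
have SsubA x : S x -> (x <= A)%MS.
  move=> Sx; apply: contrapT => /negP xA.
  have : P (\rank (col_mx A x)).
    apply/asboolP; exists (k + 1)%N, (col_mx A x); split => // i.
    rewrite -[i]splitK; case: (fintype.split i) => j /=.
      by rewrite rowKu.
    by rewrite rowKd ord1 row_id.
  move/rmax; rewrite leqNgt -rA => /negP; apply; apply: rank_ltmx.
  rewrite ltmxE; apply/andP; split.
    by rewrite -addsmxE addsmxSl.
  by apply: contra xA; apply: submx_trans; rewrite -addsmxE addsmxSr.
have AsubS x : (x <= A)%MS -> S x.
  move=> /submxP[D ->]; rewrite mulmx_sum_row.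
  elim/big_rec: _ => // i y _ Sy; exact: Slin.
have : w *m cokermx A != 0.
  by rewrite -submxE; apply/negP => /AsubS.
move=> wA; have [j wj] : exists j, (w *m cokermx A) 0 j != 0.
  apply: contrapT => h; move/eqP: wA; apply; apply/rowP => j.
  by rewrite [RHS]mxE; apply: contrapT => wj; apply: h; exists j; apply/eqP.
exists (col j (cokermx A)) => [|x /SsubA].
  apply: contra wj => /eqP wj.
  have -> : (w *m cokermx A) 0 j = (w *m col j (cokermx A)) 0 0.
    by move: (cokermx A) => B; rewrite !mxE; apply: eq_bigr => i _; rewrite !mxE.
  by rewrite wj mulmx0 mxE.
by rewrite submxE; move: (cokermx A) => B /eqP xB; rewrite colE mulmxA xB mul0mx.
Qed.

Section SingularUnique.
Context {R : realType}.
Notation mu := (@lebesgue_measure R).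
Implicit Types u v w : R -> 'rV[R]_2.

(** Lagrange multipliers, with energy component 0 by strictness. *)
Lemma singular_multiplier n q u (dFJ : (R -> 'rV[R]_2) -> 'rV[R]_3 * R^o) :
  is_L2_differential (extended_endpoint (frame n) q) u dFJ ->
  ~ (forall p, exists2 v, L2_control v & dFJ v = p) ->
  (forall (l : 'rV[R]_3) (l0 : R), (forall v, L2_control v ->
     \sum_(i < 3) l 0 i * (dFJ v).1 0 i + l0 * (dFJ v).2 = 0) -> l0 = 0) ->
  exists2 l : 'rV[R]_3, l != 0 & forall v, L2_control v ->
     l 0 0 * (dFJ v).1 0 0 + l 0 1 * (dFJ v).1 0 1 + l 0 2 * (dFJ v).1 0 2 = 0.
Proof.
move=> [dlin _ _] nsurj strict.
pose row4 (p : 'rV[R]_3 * R^o) : 'rV[R]_(3 + 1) := row_mx p.1 (p.2%:M).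
have L0 : L2_control (0 : R -> 'rV[R]_2) by exact: (@L2_cst R 0).
have d0 : dFJ 0 = 0.
  have := dlin 1 0 0 L0 L0; rewrite scale1r scale1r addr0 => /esym/eqP.
  by rewrite -subr_eq0 addrK => /eqP.
pose S : set 'rV[R]_(3 + 1) :=
  [set x | exists2 v, L2_control v & row4 (dFJ v) = x].
have [||| l l_neq0 lS] := @subspace_annihilator R (3 + 1) S.
- exists 0 => //; rewrite d0 /row4 /=.
  rewrite (_ : (0 : R)%:M = 0) ?row_mx0//.
  by apply/matrixP => i j; rewrite !mxE mul0rn.
- move=> c x y [v Lv <-] [w Lw <-]; exists (c *: v + w); first exact: L2_linear.
  rewrite dlin// /row4 /= scale_row_mx add_row_mx; congr row_mx.
  by apply/rowP => i; rewrite !ord1 !mxE eqxx !mulr1n.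
- apply: contrapT => h; apply: nsurj => w.
  have : S (row4 w) by apply: contrapT => wS; apply: h; exists (row4 w).
  move=> [v Lv vw]; exists v => //; move/eq_row_mx: vw => [e1 e2].
  rewrite [LHS]surjective_pairing [RHS]surjective_pairing e1; congr pair.
  by have := congr1 (fun M : 'M[R]_1 => M 0 0) e2; rewrite !mxE eqxx !mulr1n.
pose l3 : 'rV[R]_3 := (usubmx l)^T; pose l0 := dsubmx l 0 0.
have ann v : L2_control v ->
    \sum_(i < 3) l3 0 i * (dFJ v).1 0 i + l0 * (dFJ v).2 = 0.
  move=> Lv.
  have /(congr1 (fun M : 'M[R]_1 => M 0 0)) := lS _ (ex_intro2 _ _ v Lv erefl).
  rewrite /row4 -[l in _ *m l]vsubmxK mul_row_col !mxE big_ord1 !mxE eqxx mulr1n.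
  move=> e; rewrite -[RHS]e; congr (_ + _); last by rewrite mulrC /l0 mxE.
  by apply: eq_bigr => i _; rewrite mulrC !mxE.
have l00 := strict _ _ ann.
exists l3 => [|v Lv]; last first.
  by have := ann v Lv; rewrite sum3E l00 mul0r addr0.
apply: contra l_neq0 => /eqP l30.
rewrite -[l]vsubmxK -[usubmx l]trmxK -/l3 l30 trmx0.
rewrite (_ : dsubmx l = 0) ?col_mx0//.
by apply/matrixP => i j; rewrite !ord1 [RHS]mxE.
Qed.

Lemma coord_differential n q u dFJ (i : 'I_3) :
  is_L2_differential (extended_endpoint (frame n) q) u dFJ ->
  is_L2_differential (V := R^o) (fun v => endpoint (frame n) q v 0 i) u
    (fun v => (dFJ v).1 0 i).
Proof.
apply: (@L2_differential_comp R ('rV[R]_3 * R^o)%type R^o (fun p => p.1 0 i)).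
  by move=> c x y; rewrite /= !mxE.
move=> x; rewrite (le_trans (ler_coord _ _ _))// prod_normE.
by rewrite le_max lexx.
Qed.

Lemma energy_differential n q u dFJ :
  is_L2_differential (extended_endpoint (frame n) q) u dFJ ->
  is_L2_differential (V := R^o) (fun v => 2^-1 * L2_norm v ^+ 2) u
    (fun v => (dFJ v).2).
Proof.
apply: (@L2_differential_comp R ('rV[R]_3 * R^o)%type R^o (fun p => p.2)) => //.
by move=> x; rewrite prod_normE le_max lexx orbT.
Qed.

(** Enough to exclude a multiplier that only sees x1. *)
Lemma dF_transverse n q u dFJ : L2_control u ->
  is_L2_differential (extended_endpoint (frame n) q) u dFJ ->
  (dFJ (fun=> vec2 1 0)).1 0 0 = 1.
Proof.
move=> Lu /(coord_differential 0) dF.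
apply: (L2_differential_dir (z := 0) dF); first exact: L2_cst.
move=> e e0; have iu := L2_integrable_control Lu.
have ie := L2_integrable_control (L2Z e (@L2_cst R (vec2 1 0))).
rewrite !endpoint_hcurve//; last exact: integrable_controlD.
have [xe _ _] := hcurveE n 0 q (u + e *: (fun=> vec2 1 0)) 1.
rewrite [LHS]xe {xe}; have [-> _ _] := hcurveE n 0 q u 1.
rewrite mulr0 addr0 -addrA; congr (_ + _).
have ic : mu.-integrable `[0, 1] (EFin \o (fun=> e : R)).
  exact: integrable_itv_cst.
have <- : \int[mu]_(s in `[0, 1]) e = e * 1.
  by rewrite Rintegral_itv_cst// subr0.
rewrite -(RintegralD _ (iu 0) ic)//.
by apply: eq_Rintegral => s _; rewrite !mxE/= mulr1.
Qed.

(** Adding a multiple of v does not change x1, so the end-point is an affine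
    function of the multiple and no remainder has to be estimated. *)
Lemma dF_vertical n q u dFJ (f : R -> R) : L2_control u ->
  {within `[0, 1], continuous f} ->
  is_L2_differential (extended_endpoint (frame n) q) u dFJ ->
  let v t := vec2 0 (f t) in let x t := hcurve n 0 q u t 0 0 in
  [/\ (dFJ v).1 0 0 = 0,
    (dFJ v).1 0 1 = \int[mu]_(t in `[0, 1]) (f t * (1 - x t)) &
    (dFJ v).1 0 2 = \int[mu]_(t in `[0, 1]) (f t * x t ^+ n)].
Proof.
move=> Lu cf dF v x.
have Lv : L2_control v.
  apply: (@continuous_L2 _ (fun=> 0)) => //.
  by apply: continuous_subspaceT => ?; exact: cst_continuous.
have iu := L2_integrable_control Lu; have iv := L2_integrable_control Lv.
have xE t : x t = q 0 0 + \int[mu]_(s in `[0, t]) (u s 0 0).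
  by rewrite /x; have [-> _ _] := hcurveE n 0 q u t.
have xeE e t : q 0 0 + \int[mu]_(s in `[0, t]) ((u + e *: v) s 0 0) = x t.
  rewrite xE; congr (_ + _); apply: eq_Rintegral => s _.
  by rewrite !mxE/= mulr0 addr0.
have [acx _ _] := horizontal_hcurve n q iu.
have cx : {within `[0, 1], continuous x} by exact/ac_continuous/ac_coord.
have key (p : R -> R) e : {within `[0, 1], continuous p} ->
    \int[mu]_(s in `[0, 1]) ((u + e *: v) s 0 1 * p s) =
    \int[mu]_(s in `[0, 1]) (u s 0 1 * p s) +
    e * \int[mu]_(s in `[0, 1]) (f s * p s).
  move=> cp; have i1 := integrable_mul_cont (iu 1) cp.
  have i2 := integrable_mul_cont (within_integrable cf) cp.
  have i3 : mu.-integrable `[0, 1] (EFin \o (fun s => e * (f s * p s))).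
    exact: (integrableZl _ _ i2).
  rewrite -(RintegralZl _ _ i2)// -(RintegralD _ i1 i3)//.
  by apply: eq_Rintegral => s _; rewrite !mxE/=; ring.
have ED e : endpoint (frame n) q (u + e *: v) = hcurve n 0 q (u + e *: v) 1.
  rewrite endpoint_hcurve//; apply: integrable_controlD => //.
  exact/L2_integrable_control/L2Z.
split.
- apply: (L2_differential_dir (z := 0) (coord_differential 0 dF) Lv) => e e0.
  rewrite ED endpoint_hcurve//.
  have [xe _ _] := hcurveE n 0 q (u + e *: v) 1.
  by rewrite [LHS]xe xeE !mulr0 !addr0.
- apply: (L2_differential_dir (z := 0) (coord_differential 1 dF) Lv) => e e0.
  rewrite ED endpoint_hcurve//.
  have [_ ye _] := hcurveE n 0 q (u + e *: v) 1; rewrite [LHS]ye {ye}.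
  have [_ -> _] := hcurveE n 0 q u 1.
  rewrite mulr0 addr0 -addrA; congr (_ + _).
  rewrite -[LHS](_ : \int[mu]_(s in `[0, 1])
      ((u + e *: v) s 0 1 * (1 - x s)) = _); last first.
    by apply: eq_Rintegral => s _; rewrite xeE.
  rewrite key; last exact: within_cst_sub.
  by congr (_ + _); apply: eq_Rintegral => s _; rewrite xE.
- apply: (L2_differential_dir (z := 0) (coord_differential 2 dF) Lv) => e e0.
  rewrite ED endpoint_hcurve//.
  have [_ _ ze] := hcurveE n 0 q (u + e *: v) 1; rewrite [LHS]ze {ze}.
  have [_ _ ->] := hcurveE n 0 q u 1.
  rewrite mulr0 addr0 -addrA; congr (_ + _).
  rewrite -[LHS](_ : \int[mu]_(s in `[0, 1])
      ((u + e *: v) s 0 1 * x s ^+ n) = _); last first.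
    by apply: eq_Rintegral => s _; rewrite xeE.
  rewrite key; last exact: within_exp.
  by congr (_ + _); apply: eq_Rintegral => s _; rewrite xE.
Qed.

(** Take as vertical variation the function f = l1 (1 - x1) + l2 x1^n itself: the
    multiplier equation says that f^2 has integral 0, hence f = 0 on [0, 1].
    Since x1 = 0 at the time when eta is at the origin, l1 = 0; and l2 is not 0
    by [dF_transverse].  So x1 = 0, and then x3 is constant. *)
Lemma singular_on_axis n (eta : R -> 'rV[R]_3) : (0 < n)%N ->
  strictly_singular (frame n) eta -> through_origin eta ->
  forall t, 0 <= t <= 1 -> eta t = gamma (eta t 0 1).
Proof.
move=> n0 [u [Lu hu [dFJ [dF nsurj strict]]]] [t0 t0I eta0].
have iu := L2_integrable_control Lu.
have etaE t : 0 <= t <= 1 -> eta t = hcurve n 0 (eta 0) u t.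
  exact: horizontal_unique.
have [l l_neq0 ann] := singular_multiplier dF nsurj strict.
pose x t := hcurve n 0 (eta 0) u t 0 0.
have x_eta t : 0 <= t <= 1 -> x t = eta t 0 0 by move=> /etaE ->.
have [acx _ _] := horizontal_hcurve n (eta 0) iu.
have cx : {within `[0, 1], continuous x} by exact/ac_continuous/ac_coord.
pose f t := l 0 1 * (1 - x t) + l 0 2 * x t ^+ n.
have c1 := within_cst_sub cx; have cn := @within_exp _ _ _ _ n cx.
have cf : {within `[0, 1], continuous f}.
  move=> t; apply: cvgD; apply: cvgMl_tmp; [exact: c1|exact: cn].
have Lf : L2_control (fun t => vec2 0 (f t)).
  apply: (@continuous_L2 _ (fun=> 0)) => //.
  by apply: continuous_subspaceT => ?; exact: cst_continuous.
have f0 t : 0 <= t <= 1 -> f t = 0.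
  have [d0 d1 d2] := dF_vertical Lu cf dF.
  have := ann _ Lf; rewrite d0 d1 d2 mulr0 add0r -/x.
  have i1 := integrable_mul_cont (within_integrable cf) c1.
  have i2 := integrable_mul_cont (within_integrable cf) cn.
  have i1' : mu.-integrable `[0, 1] (EFin \o (fun t => l 0 1 * (f t * (1 - x t)))).
    exact: (integrableZl _ _ i1).
  have i2' : mu.-integrable `[0, 1] (EFin \o (fun t => l 0 2 * (f t * x t ^+ n))).
    exact: (integrableZl _ _ i2).
  rewrite -(RintegralZl _ _ i1)// -(RintegralZl _ _ i2)// -(RintegralD _ i1' i2')//.
  have -> : \int[mu]_(t in `[0, 1])
      (l 0 1 * (f t * (1 - x t)) + l 0 2 * (f t * x t ^+ n)) =
      \int[mu]_(t in `[0, 1]) (f t ^+ 2).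
    by apply: eq_Rintegral => s _; rewrite /f; ring.
  move=> ff0 tI; apply/eqP/negPn/negP => ft.
  have : 0 < \int[mu]_(t in `[0, 1]) (f t ^+ 2).
    apply: (@Rintegral_gt0 _ 0 1 t) => //.
    - exact: within_exp.
    - by move=> s _; exact: sqr_ge0.
    - by rewrite exprn_even_gt0.
  by rewrite ff0 ltxx.
have l1 : l 0 1 = 0.
  have := f0 _ t0I; rewrite /f x_eta// eta0 mxE expr0n eqn0Ngt n0 subr0.
  by rewrite mulr1 mulr0 addr0.
have l2 : l 0 2 != 0.
  apply: contra l_neq0 => /eqP l2.
  have := ann _ (@L2_cst R (vec2 1 0)).
  rewrite (dF_transverse Lu dF) l1 l2 !mul0r !addr0 mulr1 => l00.
  by apply/eqP/rowP; apply: ord3P; rewrite mxE.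
have x0 t : 0 <= t <= 1 -> x t = 0.
  move=> tI; have := f0 t tI; rewrite /f l1 mul0r add0r => /eqP.
  by rewrite mulf_eq0 (negbTE l2) expf_eq0 n0 => /eqP.
have zE t : 0 <= t <= 1 -> eta t 0 2 = eta 0 0 2.
  move=> tI; have [_ _ ->] := horizontal_integral hu iu tI.
  rewrite (_ : \int[mu]_(s in _) _ = 0) ?addr0//.
  rewrite -[RHS](mul0r (\int[mu]_(s in `[0, t]) 1)) -RintegralZl//; last first.
    exact: integrable_itv_cst.
  apply: eq_Rintegral => s; rewrite inE/= in_itv/= => /andP[s0 st].
  have sI : 0 <= s <= 1 by rewrite s0 (le_trans st)//; case/andP: tI.
  by rewrite -x_eta// x0// expr0n eqn0Ngt n0 !mulr0 mul0r.
move=> t tI; rewrite [LHS]vec3_eta -x_eta// x0// zE//.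
by rewrite -(zE t0)// eta0 mxE.
Qed.

(** A constant curve has control 0 almost everywhere, where the energy has
    differential 0; then the covector with only an energy component kills the
    image. *)
Lemma singular_nonconstant n (eta : R -> 'rV[R]_3) : (0 < n)%N ->
  strictly_singular (frame n) eta ->
  (forall t, 0 <= t <= 1 -> eta t = gamma (eta t 0 1)) ->
  exists s t, [/\ 0 <= s <= 1, 0 <= t <= 1 & eta s 0 1 != eta t 0 1].
Proof.
move=> n0 [u [Lu hu [dFJ [dF nsurj strict]]]] axis.
apply: contrapT => ncst.
have I0 : 0 <= (0 : R) <= 1 by rewrite lexx ler01.
have const t : 0 <= t <= 1 -> eta t = eta 0.
  move=> tI; rewrite axis// [RHS]axis//; congr gamma.
  by apply/eqP/negPn/negP => h; apply: ncst; exists t, 0.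
have u0 : {ae mu, forall t, 0 <= t <= 1 -> u t = 0}.
  case: hu => _ _ du.
  have ae01 := ae_imply2 (fun t => @conj _ _) (@ae_neq R 0) (@ae_neq R 1).
  apply: (ae_imply2 _ du ae01).
  move=> t dut [t0 t1] tI; have {}dut := dut tI.
  have {}t0 : 0 < t by rewrite lt_neqAle eq_sym t0; case/andP: tI.
  have {}t1 : t < 1 by rewrite lt_neqAle t1; case/andP: tI.
  have d0 : is_derive t 1 eta 0.
    apply: (@near_eq_is_derive _ _ _ (cst (eta 0))).
    exists (Num.min t (1 - t)); first by rewrite /= lt_min t0 subr_gt0.
    move=> s /=; rewrite lt_min !ltr_norml => /andP[/andP[? ?] /andP[? ?]].
    by rewrite const//; apply/andP; split; lra.
  have [_ e1] := dut; have [_ e2] := d0.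
  move: e2; rewrite e1 frame_vec3.
  have -> : eta t 0 0 = 0 by rewrite axis// mxE.
  rewrite subr0 mulr1 => e; apply/rowP => j; elim/ord2P: j; rewrite [RHS]mxE.
  - by have := congr1 (fun p : 'rV[R]_3 => p 0 0) e; rewrite vec3E mxE.
  - by have := congr1 (fun p : 'rV[R]_3 => p 0 1) e; rewrite vec3E mxE.
have energy v : L2_control v -> (dFJ v).2 = 0.
  move=> Lv; apply: (L2_differential_dir (z := 2^-1 * L2_norm v ^+ 2)
    (energy_differential dF) Lv) => e e0.
  have ue w : L2_control w -> L2_norm (u + w) = L2_norm w.
    move=> Lw; rewrite /L2_norm; congr Num.sqrt; congr fine.
    have Luw : L2_control (u + w) by rewrite -[u]scale1r; exact: L2_linear.
    have [_ /measurable_int m1] := Luw; have [_ /measurable_int m2] := Lw.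
    apply: ae_eq_integral => //.
    apply: (ae_imply _ u0) => t ut; rewrite /= in_itv/= => /ut {}ut.
    congr (_%:E); congr (enorm _ ^+ 2).
    by rewrite /GRing.add/= ut add0r.
  rewrite ue; last exact: L2Z.
  have -> : L2_norm u = 0.
    have L0 : L2_control (0 : R -> 'rV[R]_2) by exact: (@L2_cst R 0).
    rewrite -[u]addr0 ue//.
    by have := L2_normZ (lexx 0) L0; rewrite scale0r mul0r.
  by rewrite L2_normZ ?ltW//; ring.
suff /eqP : (1 : R) = 0 by rewrite oner_eq0.
apply: (strict 0) => v Lv; rewrite energy// mulr0 addr0.
by rewrite big1// => i _; rewrite mxE mul0r.
Qed.

Lemma strictly_singular_reparameterization n (eta : R -> 'rV[R]_3) :
  (0 < n)%N -> strictly_singular (frame n) eta -> through_origin eta ->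
  exists2 phi : R -> R, reparameterization eta gamma phi &
    {in `[0, 1] &, injective eta} -> strictly_monotone phi.
Proof.
move=> n0 Seta Oeta; have axis := singular_on_axis n0 Seta Oeta.
have [u [Lu [aceta _ _] _]] := Seta.
have acphi := ac_coord 1 aceta.
exists (fun t => eta t 0 1).
  by split => //; exact: singular_nonconstant Seta axis.
move=> inj; apply: (itv_continuous_inj_mono (ac_continuous acphi)).
move=> s t sI tI st; apply: inj => //.
by rewrite axis ?(itvP sI)// [RHS]axis ?(itvP tI)// st.
Qed.

End SingularUnique.

(** * The theorem *)

Theorem theorem10p1 (R : realType) (n : nat) :
  [/\ (2 <= n)%N ->
      [/\ strictly_singular (frame n) (@gamma R),
          through_origin (@gamma R) &
          forall eta : R -> 'rV[R]_3,
            strictly_singular (frame n) eta -> through_origin eta ->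
            exists2 phi : R -> R, reparameterization eta gamma phi &
              {in `[0, 1] &, injective eta} -> strictly_monotone phi],
      (2 <= n)%N -> ~~ odd n ->
      locally_length_minimizing (frame n) 0 1 (@gamma R) &
      (3 <= n)%N -> odd n ->
      ~ length_minimizing (frame n) 0 1 (@gamma R) /\
      ~ locally_length_minimizing (frame n) 0 1 (@gamma R)].
Proof.
split=> [n2|n2 ne|n3 on].
- split; first exact: gamma_strictly_singular.
    exists 0; first by rewrite lexx ler01.
    by apply/rowP; apply: ord3P; rewrite !mxE.
  by move=> eta; apply: strictly_singular_reparameterization; exact: ltnW.
- by apply: even_locally_minimizing => //; exact: ltnW.
- split; last by apply: odd_not_locally_minimizing => //; exact: ltnW.
  by apply: odd_not_minimizing => //; exact: ltnW.
Qed.
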